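(* Let $Y$ be the bounded strong solution of the call-side obstacle problem and let $$B(\tau)=\min\{x:\ln K_1\le x\le\ln k_1,\ Y(x,\tau)=e^x-K_1+K_2-k_1\},\qquad\tau\in(0,T],$$ be its upper free boundary. Let $$\xi:=\max\left\{\ln K_1,\ \ln\frac{r(K_1+k_1-K_2)}{q}\right\},$$ where the second term is understood as $-\infty$ if $q=0$ or $K_1+k_1\le K_2$. (i) If $q=0$ and $K_1+k_1\ge K_2$, or if $q>0$ and $\xi\ge\ln k_1$, then $B(\tau)=\ln k_1$ for all $\tau\in(0,T]$. (In this case the call is never exercised before the price of the underlying asset reaches $k_1$, i.e. $Y(x,\tau)>\psi_1(x)$ for all $x\in[\ln K_1,\ln k_1)$, $\tau\in(0,T]$.) (ii) If $q=0$ and $K_1+k_1<K_2$, or if $q>0$ and $\xi<\ln k_1$, then $B$ is nondecreasing and continuous on $(0,T]$, it is strictly increasing on $\{\tau\in(0,T]:B(\tau)<\ln k_1\}$, and $$B(0):=\lim_{\tau\searrow0}B(\tau)=\xi.$$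
   Context: Constants: $0<K_1<k_1<k_2<K_2$, $\sigma>0$, $r>0$, $q\ge0$, $T>0$. Put $\mathcal Lu:=\frac{\sigma^2}{2}\partial_{xx}u+\left(r-q-\frac{\sigma^2}{2}\right)\partial_xu-ru$ and $\psi_1(x):=(e^x-K_1)^++K_2-k_1$. Let $Q=(-\infty,\ln k_1)\times(0,T]$. For $1<p<\infty$, $\mathcal W_p(Q)$ is the set of $u\in C((-\infty,\ln k_1]\times[0,T])$ such that, for all $R,\rho>0$, $u,\partial_xu,\partial_{xx}u,\partial_\tau u$ (weak derivatives) belong to $L^p$ of $\left(((-\infty,\ln k_1)\cap(-R,R))\times(0,T)\right)\setminus B_\rho(\ln K_1,0)$, where $B_\rho$ denotes an open disc of radius $\rho$. A strong solution of the call-side obstacle problem is a function $Y\in\mathcal W_p(Q)$ with $Y\ge\psi_1$ in $Q$, $\partial_\tau Y-\mathcal LY\ge0$ almost everywhere in $Q$, $\partial_\tau Y-\mathcal LY=0$ almost everywhere on $\{Y>\psi_1\}$, $Y(x,0)=\psi_1(x)$ for $x<\ln k_1$, and $Y(\ln k_1,\tau)=K_2-K_1$ for $\tau\in[0,T]$. For every $1<p<\infty$ there is exactly one bounded strong solution, and it does not depend on $p$. For each $\tau\in(0,T]$ the set $\{x\in[\ln K_1,\ln k_1]:Y(x,\tau)=\psi_1(x)\}$ is a nonempty closed interval $[B(\tau),\ln k_1]$ with $B(\tau)>\ln K_1$. *)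

(* Defs.v *)
From HB Require Import structures.
From mathcomp Require Export all_boot all_order all_algebra.
From mathcomp Require Export all_classical all_reals all_analysis.
Export Order.TTheory GRing.Theory Num.Theory.
Export numFieldNormedType.Exports.

Set Implicit Arguments.
Unset Strict Implicit.
Unset Printing Implicit Defensive.

Local Open Scope classical_set_scope.
Local Open Scope ring_scope.

(* Points of the (x, tau)-plane are pairs z : R * R with z.1 = x, z.2 = tau. *)
Section plane.
Context (R : realType).

Definition leb2 := ((@lebesgue_measure R) \x (@lebesgue_measure R))%E.

Definition dx (f : R * R -> R) (z : R * R) : R := derive1 (fun x => f (x, z.2)) z.1.
Definition dtau (f : R * R -> R) (z : R * R) : R := derive1 (fun t => f (z.1, t)) z.2.

Fixpoint Ck (n : nat) (f : R * R -> R) : Prop :=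
  if n is m.+1 then
    [/\ continuous f,
        forall z, derivable (fun x => f (x, z.2)) z.1 1,
        forall z, derivable (fun t => f (z.1, t)) z.2 1,
        Ck m (dx f) & Ck m (dtau f)]
  else continuous f.

Definition test_function (U : set (R * R)) (phi : R * R -> R) : Prop :=
  (forall n, Ck n phi) /\
  exists K, [/\ compact K, K `<=` U & forall z, ~ K z -> phi z = 0].

(* mathcomp-analysis only has locally_integrable for functions of one variable. *)
Definition locally_integrable2 (U : set (R * R)) (f : R * R -> R) : Prop :=
  forall K, compact K -> K `<=` U -> leb2.-integrable K (EFin \o f).

(* g is the weak derivative D u in the open set U, where D is one of the
   classical partial differential operators above (or a composite) and k is
   its order. *)
Definition weak_derivative (U : set (R * R))
    (D : (R * R -> R) -> (R * R -> R)) (k : nat) (u g : R * R -> R) : Prop :=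
  [/\ locally_integrable2 U u, locally_integrable2 U g &
      forall phi, test_function U phi ->
        Rintegral leb2 U (fun z => u z * D phi z) =
        (-1) ^+ k * Rintegral leb2 U (fun z => g z * phi z)].

Definition in_Lp (p : R) (A : set (R * R)) (f : R * R -> R) : Prop :=
  measurable_fun A f /\ (\int[leb2]_(z in A) (`|f z| `^ p)%:E < +oo)%E.

End plane.

Section obstacle_problem.
Context (R : realType).
(* K1 < k1 < k2 < K2; neither the operator nor the call side involves k2. *)
Variables (K1 k1 K2 sigma r q T : R).

Definition Lop (u ux uxx : R) : R :=
  sigma ^+ 2 / 2 * uxx + (r - q - sigma ^+ 2 / 2) * ux - r * u.

Definition psi1 (x : R) : R := Num.max (expR x - K1) 0 + K2 - k1.

Definition Qset : set (R * R) :=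
  [set z | z.1 < ln k1 /\ 0 < z.2 <= T].
Definition Qinterior : set (R * R) :=
  [set z | z.1 < ln k1 /\ 0 < z.2 < T].
Definition Qclosure : set (R * R) :=
  [set z | z.1 <= ln k1 /\ 0 <= z.2 <= T].

(* The half-strip, truncated at |x| < S, minus the Euclidean disc of radius
   rho about (ln K1, 0). *)
Definition Qlocal (S rho : R) : set (R * R) :=
  [set z | [/\ z.1 < ln k1, - S < z.1 < S, 0 < z.2 < T &
               ~ ((z.1 - ln K1) ^+ 2 + z.2 ^+ 2 < rho ^+ 2)]].

(* u lies in W_p(Q), with weak derivatives ux, uxx, ut.  Every compact subset
   of the interior of Q lies in some Qlocal S rho, so that weak derivatives on
   all the local domains amount to weak derivatives on the interior of Q. *)
Definition Wp_with (p : R) (u ux uxx ut : R * R -> R) : Prop :=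
  [/\ {within Qclosure, continuous u},
      weak_derivative Qinterior (@dx R) 1 u ux,
      weak_derivative Qinterior (@dx R \o @dx R) 2 u uxx,
      weak_derivative Qinterior (@dtau R) 1 u ut &
      forall S rho : R, 0 < S -> 0 < rho ->
        [/\ in_Lp p (Qlocal S rho) u, in_Lp p (Qlocal S rho) ux,
            in_Lp p (Qlocal S rho) uxx & in_Lp p (Qlocal S rho) ut]].

Definition strong_solution (p : R) (Y : R * R -> R) : Prop :=
  (exists Yx Yxx Yt : R * R -> R,
    [/\ Wp_with p Y Yx Yxx Yt,
        {ae @leb2 R, forall z, Qset z -> 0 <= Yt z - Lop (Y z) (Yx z) (Yxx z)} &
        {ae @leb2 R, forall z, Qset z -> psi1 z.1 < Y z ->
           Yt z - Lop (Y z) (Yx z) (Yxx z) = 0}]) /\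
  [/\ forall z, Qset z -> psi1 z.1 <= Y z,
      forall x : R, x < ln k1 -> Y (x, 0) = psi1 x &
      forall tau : R, 0 <= tau <= T -> Y (ln k1, tau) = K2 - K1].

Definition bounded_strong_solution (p : R) (Y : R * R -> R) : Prop :=
  strong_solution p Y /\ [bounded Y z | z in Qclosure].

Definition contact_set (Y : R * R -> R) (tau : R) : set R :=
  [set x | ln K1 <= x <= ln k1 /\ Y (x, tau) = expR x - K1 + K2 - k1].

Definition is_upper_free_boundary (Y : R * R -> R) (B : R -> R) : Prop :=
  forall tau : R, 0 < tau <= T ->
    contact_set Y tau (B tau) /\ lbound (contact_set Y tau) (B tau).

(* In the first case the logarithm is read as -oo, and the maximum is ln K1. *)
Definition xi : R :=
  if (q == 0) || (K1 + k1 <= K2) then ln K1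
  else Num.max (ln K1) (ln (r * (K1 + k1 - K2) / q)).

End obstacle_problem.

(* Main.v *)
(** Write [P = d/dtau - L].  Testing the weak derivatives against translates of a
tensor-product bump function and using that [P] has constant coefficients, [Y]
is locally a uniform limit of smooth functions [U] with [P U >= 0], and of
smooth functions with [P U = 0] off the contact set.  This notion of
supersolution is additive, so that differences of time translates of [Y] can be
treated directly, and it suffices for the maximum principle; no Sobolev
embedding and no smoothness of [Y] across the free boundary is needed.

Comparing [Y(., . + h)] with [Y] shows that [Y] is nondecreasing in [tau], so
contact persists backward in time and [B] is nondecreasing.  On [x > ln K1] the
payoff [g] satisfies [P g = q e^x - r (K1 + k1 - K2)], which changes sign at [xi];
hence there is no contact on [(ln K1, xi)], and contact at [x1 >= xi] forces
contact on [[x1, ln k1]].  A supersolution cannot have a convex kink, which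
excludes contact at [ln K1].  If [B] jumped at some time, or [B(0+) > xi], then
[Y] would solve [P Y = 0] on a rectangle starting from [Y = g] with [P g > 0],
and would immediately drop below [g].  If [B] were constant on a time interval,
a Hopf barrier applied to [Y(., . + h) - Y] would make [Y - g] grow linearly to
the left of the boundary, again a convex kink. *)

Require Import Defs.
From mathcomp Require Import ring lra measurable_realfun lebesgue_integral_under.

Set Implicit Arguments.
Unset Strict Implicit.
Unset Printing Implicit Defensive.

Local Open Scope classical_set_scope.
Local Open Scope ring_scope.

(** * Calculus and compactness *)

Section calculus.
Context {R : realType}.
Implicit Types (f g : R -> R) (u : R * R -> R).

(** Two limits on what is known about [Y] shape the proof. The equation [P Y = 0] holds only off the
    contact set, whose position is unknown. The comparison principle therefore asks for the
    supersolution property only where the desired inequality fails: if [Y] exceeds a later time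
    translate of itself, or exceeds [g] to the right of [ln K1], then [Y > psi1] there, and [-Y] is
    a supersolution. Moreover the weak derivatives live on an open set, so the equation says nothing
    at time [T]. Monotonicity reaches [T] by continuity, and contact at [T] is transported to
    earlier times, where it can be refuted.

    In case (i), [P g <= 0] on the whole of [(ln K1, ln k1)], so that [Y - g] is a nonnegative
    supersolution which is positive at [ln K1], and the Hopf barrier keeps it positive up to
    [ln k1]. This also settles the borderline [q = 0], [K1 + k1 = K2], in which [P g] vanishes
    identically and its sign gives no information. *)

Lemma ex_small (s : seq R) : all (fun x => 0 < x) s ->
  exists2 d : R, 0 < d & all (fun x => d < x) s.
Proof.
elim: s => [|x s IH] /=; first by exists 1.
move=> /andP[x0 /IH[d d0 ds]]; exists (Num.min d x / 2).
  by rewrite divr_gt0// lt_min d0.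
have m0 : 0 < Num.min d x by rewrite lt_min d0.
have h : Num.min d x / 2 < Num.min d x by rewrite ltr_pdivrMr// ltr_pMr// ltrDl.
rewrite (lt_le_trans h) ?ge_min ?lexx ?orbT//=.
by apply: sub_all ds => y dy; rewrite (lt_trans h)// gt_min dy.
Qed.

Lemma continuous_square u z e : continuous u -> 0 < e ->
  exists2 d, 0 < d & forall w, `|w.1 - z.1| < d -> `|w.2 - z.2| < d ->
    `|u w - u z| < e.
Proof.
move=> cu e0; have /cvgrPdist_lt/(_ _ e0)/nbhs_ballP[d d0 dP] := cu z.
exists d => // w w1 w2; rewrite distrC; apply: dP; split => /=.
  by rewrite /ball /= distrC.
by rewrite /ball /= distrC.
Qed.

Lemma compact_box (a b c d : R) : compact (`[a, b] `*` `[c, d]).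
Proof. by apply: compact_setX; exact: segment_compact. Qed.

Lemma boxP (a b c d : R) (z : R * R) :
  (`[a, b] `*` `[c, d]) z <-> [/\ a <= z.1, z.1 <= b, c <= z.2 & z.2 <= d].
Proof.
split=> [[]/=|[h1 h2 h3 h4]]; first by rewrite !in_itv /= => /andP[-> ->] /andP[-> ->].
by split; rewrite /= in_itv /=; apply/andP.
Qed.

Lemma box_min (a b c d : R) u : a <= b -> c <= d ->
  {within `[a, b] `*` `[c, d], continuous u} ->
  exists z, [/\ a <= z.1, z.1 <= b, c <= z.2, z.2 <= d &
    forall w, a <= w.1 -> w.1 <= b -> c <= w.2 -> w.2 <= d -> u z <= u w].
Proof.
move=> ab cd cu.
have ne : (`[a, b] `*` `[c, d] : set (R * R)) !=set0.
  by exists (a, c); apply/boxP.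
have [z zK zmin] := compact_EVT_min ne (compact_box (a := a) (b := b) (c := c) (d := d)) cu.
move: zK; rewrite inE => /boxP[z1 z2 z3 z4].
exists z; split=> // w w1 w2 w3 w4; apply: zmin.
by rewrite inE; apply/boxP.
Qed.

Lemma is_derive1_near f (x df e : R) : is_derive x 1 f df -> 0 < e ->
  exists2 d, 0 < d & forall h, h != 0 -> `|h| < d ->
    `|h^-1 * (f (x + h) - f x) - df| < e.
Proof.
move=> [dv dE] e0.
have : h^-1 *: ((f \o shift x) (h *: 1) - f x) @[h --> 0^'] --> df.
  by rewrite -dE; exact: dv.
move/cvgrPdist_lt => /(_ _ e0)/nbhs_ballP[d d0 dP].
exists d => // h h0 hd; rewrite distrC.
have := dP h; rewrite /ball /= sub0r normrN => /(_ hd h0).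
by rewrite [h *: 1]mulr1 (addrC h).
Qed.

Lemma derive_left_min_le0 f (x df d : R) : is_derive x 1 f df -> 0 < d ->
  (forall y, x - d <= y -> y <= x -> f x <= f y) -> df <= 0.
Proof.
move=> fx d0 fmin; rewrite leNgt; apply/negP => df0.
have [e e0 eP] := is_derive1_near fx df0.
pose h := Num.min d (e / 2).
have h0 : 0 < h by rewrite lt_min d0 divr_gt0.
have he : h < e by rewrite gt_min [e / 2 < e]ltr_pdivrMr// mulr_natr mulr2n ltrDl e0 orbT.
have hd : h <= d by rewrite ge_min lexx.
have hN0 : - h != 0 by rewrite oppr_eq0 gt_eqF.
have := eP (- h) hN0; rewrite normrN gtr0_norm// => /(_ he).
have fm : f x <= f (x - h) by apply: fmin; lra.
suff : (- h)^-1 * (f (x - h) - f x) <= 0.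
  by move=> q /ltr_normlP[]; lra.
by rewrite invrN mulNr oppr_le0 mulr_ge0// ?invr_ge0 ?subr_ge0// ltW.
Qed.

(** If [d2 < 0], differentiability of [f'] at the single point [x] makes [f'] negative just to the
    right of [x]. The mean value theorem on [[x, x + h]] contradicts this. *)
Lemma second_derive_min_ge0 f f' (x d2 d : R) : 0 < d ->
  (forall y, `|y - x| < d -> is_derive y 1 f (f' y)) ->
  is_derive x 1 f' d2 -> (forall y, `|y - x| < d -> f x <= f y) ->
  f' x = 0 /\ 0 <= d2.
Proof.
move=> d0 ff' f'x fmin.
have inball y : y \in `]x - d, x + d[%R -> `|y - x| < d.
  by rewrite in_itv /= => /andP[? ?]; apply/ltr_normlP; split; lra.
have f'x0 : f' x = 0.
  have xx : `|x - x| < d by rewrite subrr normr0.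
  have -> : f' x = 'D_1 f x by have [_ ->] := ff' _ xx.
  suff [_ ->] : is_derive x 1 f 0 by [].
  apply: (@derive1_at_min _ f (x - d) (x + d)); first lra.
  - by move=> t /inball /ff'[].
  - by rewrite in_itv /=; apply/andP; split; lra.
  - by move=> t /inball; exact: fmin.
split=> //; rewrite leNgt; apply/negP => d20.
have [e e0 eP] := is_derive1_near f'x (e := - d2) ltac:(lra).
pose h := Num.min d e / 2.
have m0 : 0 < Num.min d e by rewrite lt_min d0.
have md : Num.min d e <= d by rewrite ge_min lexx.
have me : Num.min d e <= e by rewrite ge_min lexx orbT.
have [h0 hd he] : [/\ 0 < h, h < d & h < e] by split; rewrite /h; lra.
have [|||c ] := @MVT _ f f' x (x + h).
- lra.
- move=> y; rewrite in_itv /= => /andP[? ?]; apply: ff'.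
  by rewrite gtr0_norm; lra.
- apply: derivable_within_continuous => y; rewrite in_itv /= => /andP[? ?].
  have /ff'[] // : `|y - x| < d by rewrite ger0_norm; lra.
- rewrite in_itv /= => /andP[xc ch] fE.
  have fh : f x <= f (x + h) by apply: fmin; rewrite addrC addKr gtr0_norm.
  have cx0 : c - x != 0 by rewrite gt_eqF; lra.
  have := eP (c - x) cx0; rewrite gtr0_norm; last lra.
  rewrite (addrC x) subrK f'x0 subr0 => /(_ ltac:(lra)).
  have f'c : 0 <= f' c.
    have : 0 <= f' c * (x + h - x) by rewrite -fE; lra.
    by rewrite addrAC subrr add0r pmulr_lge0.
  move=> /ltr_normlP[_]; have : 0 <= (c - x)^-1 * f' c.
    by rewrite mulr_ge0// invr_ge0; lra.
  lra.
Qed.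

End calculus.

(** * Supersolutions and the comparison principle *)

Section comparison.
Context {R : realType}.
Variables (sigma r q : R).
Implicit Types (u v U : R * R -> R) (z w : R * R).

Definition square z (rho : R) : set (R * R) :=
  `[z.1 - rho, z.1 + rho] `*` `[z.2 - rho, z.2 + rho].

Definition C21_at (U Ux Uxx Ut : R * R -> R) z : Prop :=
  [/\ is_derive z.1 1 (fun x => U (x, z.2)) (Ux z),
      is_derive z.1 1 (fun x => Ux (x, z.2)) (Uxx z) &
      is_derive z.2 1 (fun t => U (z.1, t)) (Ut z)].

Definition residual (U Ux Uxx Ut : R * R -> R) z : R :=
  Ut z - Lop sigma r q (U z) (Ux z) (Uxx z).

(* The radius does not depend on the precision [e]. *)
Definition supersol_at u z : Prop :=
  exists2 rho, 0 < rho & forall e, 0 < e ->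
  exists U Ux Uxx Ut : R * R -> R,
    {within square z rho, continuous U} /\
    forall w, square z rho w ->
      [/\ C21_at U Ux Uxx Ut w, `|U w - u w| <= e & 0 <= residual U Ux Uxx Ut w].

Lemma square_subset z z' rho rho' :
  `|z'.1 - z.1| <= rho - rho' -> `|z'.2 - z.2| <= rho - rho' ->
  square z' rho' `<=` square z rho.
Proof.
move=> /ler_normlP[? ?] /ler_normlP[? ?] w /boxP[? ? ? ?]; apply/boxP; split; lra.
Qed.

Lemma supersol_atD u v z :
  supersol_at u z -> supersol_at v z -> supersol_at (u \+ v) z.
Proof.
move=> [ru ru0 uP] [rv rv0 vP]; exists (Num.min ru rv); first by rewrite lt_min ru0.
move=> e e0; have e20 : 0 < e / 2 by lra.
have [U [Ux [Uxx [Ut [cU UP]]]]] := uP _ e20.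
have [V [Vx [Vxx [Vt [cV VP]]]]] := vP _ e20.
have su : square z (Num.min ru rv) `<=` square z ru.
  by apply: square_subset; rewrite subrr normr0 subr_ge0 ge_min lexx.
have sv : square z (Num.min ru rv) `<=` square z rv.
  by apply: square_subset; rewrite subrr normr0 subr_ge0 ge_min lexx orbT.
exists (U \+ V), (Ux \+ Vx), (Uxx \+ Vxx), (Ut \+ Vt); split.
  move=> w; apply: continuousD.
    exact: (continuous_subspaceW su cU).
  exact: (continuous_subspaceW sv cV).
move=> w sw; have [[U1 U2 U3] Uu UR] := UP _ (su _ sw).
have [[V1 V2 V3] Vv VR] := VP _ (sv _ sw).
split; first by split; apply: is_deriveD.
  have -> : (U \+ V) w - (u \+ v) w = (U w - u w) + (V w - v w) by rewrite /=; ring.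
  by rewrite (le_trans (ler_normD _ _))//; lra.
move: UR VR; rewrite /residual /Lop /=; lra.
Qed.

(** By linearity of [P], the constant contributes [r c]. The penalty loses at most [k] through its
    time derivative, [k sigma^2] through its second derivative and [2 k |drift|] through its slope;
    its zeroth-order term is nonnegative. *)
Lemma residual_sub_ge (c k : R) v vx vxx vt U Ux Uxx Ut z0 z : `|z.1 - z0.1| <= 1 -> z.2 <= z0.2 ->
  0 <= k -> 0 <= r ->
  0 <= residual U Ux Uxx Ut z -> residual v vx vxx vt z <= 0 ->
  r * c - k * (1 + sigma ^+ 2 + 2 * `|r - q - sigma ^+ 2 / 2|) <=
  residual (fun w => U w - v w + c + k * ((w.1 - z0.1) ^+ 2 + (z0.2 - w.2)))
    (fun w => Ux w - vx w + k * (2 * (w.1 - z0.1)))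
    (fun w => Uxx w - vxx w + k * 2)
    (fun w => Ut w - vt w + k * - 1) z.
Proof.
move=> z1 z2 k0 r0; rewrite /residual /Lop.
set m := r - q - _ => UR vR.
have mz : m * (z.1 - z0.1) <= `|m|.
  rewrite (le_trans (ler_norm _))// normrM ler_piMr//.
have : 0 <= k * (`|m| - m * (z.1 - z0.1)) by rewrite mulr_ge0// subr_ge0.
have : 0 <= r * (k * ((z.1 - z0.1) ^+ 2 + (z0.2 - z.2))).
  by rewrite !mulr_ge0// addr_ge0 ?sqr_ge0 ?subr_ge0.
have : sigma ^+ 2 / 2 * (k * 2) = k * sigma ^+ 2 by field.
lra.
Qed.

End comparison.

Section maximum_principle.
Context {R : realType}.
Variables (sigma r q : R).
Implicit Types (u v U : R * R -> R) (z w : R * R).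

(* Only past points compete in time, hence [Wt z <= 0] rather than [Wt z = 0]. *)
Lemma residual_at_min (W Wx Wxx Wt : R * R -> R) z d : 0 < d ->
  (forall w, `|w.1 - z.1| < d -> z.2 - d < w.2 -> w.2 <= z.2 ->
     C21_at W Wx Wxx Wt w /\ W z <= W w) ->
  residual sigma r q W Wx Wxx Wt z <= r * W z.
Proof.
move=> d0 H.
have zz : `|z.1 - z.1| < d by rewrite subrr normr0.
have zd : z.2 - d < z.2 by lra.
have [[Wz1 Wz2 Wz3] _] := H z zz zd (lexx _).
have [Wx0 Wxx0] : Wx z = 0 /\ 0 <= Wxx z.
  have := @second_derive_min_ge0 _ (fun x => W (x, z.2)) (fun x => Wx (x, z.2)) z.1 (Wxx z) d d0.
  rewrite -surjective_pairing; apply => //.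
    by move=> y yd; have [[]] := H (y, z.2) yd zd (lexx _).
  by move=> y yd; have [] := H (y, z.2) yd zd (lexx _).
have Wt0 : Wt z <= 0.
  apply: (@derive_left_min_le0 _ (fun t => W (z.1, t)) z.2 (Wt z) (d / 2)) => //; first lra.
  move=> y y1 y2; rewrite -surjective_pairing.
  by have [] := H (z.1, y) zz ltac:(rewrite /=; lra) y2.
rewrite /residual /Lop Wx0.
have : 0 <= sigma ^+ 2 / 2 * Wxx z.
  by rewrite mulr_ge0// divr_ge0// sqr_ge0.
lra.
Qed.

Lemma C21_penalized U Ux Uxx Ut v vx vxx vt z0 c k z :
  C21_at U Ux Uxx Ut z -> C21_at v vx vxx vt z ->
  C21_at (fun w => U w - v w + c + k * ((w.1 - z0.1) ^+ 2 + (z0.2 - w.2)))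
    (fun w => Ux w - vx w + k * (2 * (w.1 - z0.1)))
    (fun w => Uxx w - vxx w + k * 2)
    (fun w => Ut w - vt w + k * - 1) z.
Proof.
move=> [U1 U2 U3] [v1 v2 v3]; split => /=;
  by apply: is_derive_eq; rewrite /GRing.scale /=; ring.
Qed.

(* At a negative minimum [z0] of [u - v], the minimum of the smooth function
   [U - v + m + k ((x - x0)^2 + (s0 - s))] over a past neighbourhood of [z0] is
   interior in [x], so that [P] of it is at most [r] times its value there.  The
   condition [0 < r] makes the contradiction strict even though [P v <= 0]. *)
Lemma comparison_box (a b s0 s1 : R) u v vx vxx vt :
  0 < r -> a <= b -> s0 <= s1 -> continuous u -> continuous v ->
  (forall z, a < z.1 -> z.1 < b -> s0 < z.2 -> z.2 <= s1 ->
    C21_at v vx vxx vt z /\ residual sigma r q v vx vxx vt z <= 0) ->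
  (forall z, a <= z.1 -> z.1 <= b -> s0 <= z.2 -> z.2 <= s1 -> u z < v z ->
    [/\ a < z.1, z.1 < b, s0 < z.2 & supersol_at sigma r q u z]) ->
  forall z, a <= z.1 -> z.1 <= b -> s0 <= z.2 -> z.2 <= s1 -> v z <= u z.
Proof.
move=> r0 ab s01 cu cv vP uvP z za zb zs0 zs1.
have cuv : continuous (fun w => u w - v w).
  by move=> w; apply: continuousB; [exact: cu|exact: cv].
have [z0 [z0a z0b z0s0 z0s1 z0min]] := box_min ab s01 (continuous_subspaceT cuv).
suff : 0 <= u z0 - v z0 by move=> ?; have := z0min z za zb zs0 zs1; lra.
rewrite leNgt; apply/negP => uv0.
set m := v z0 - u z0; have m0 : 0 < m by rewrite /m; lra.
have [az0 bz0 sz0 [rho rho0 rhoP]] := uvP z0 z0a z0b z0s0 z0s1 ltac:(lra).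
have [|d d0 /and5P[drho d1 da db /andP[ds _]]] :=
    ex_small (s := [:: rho; 1; z0.1 - a; b - z0.1; z0.2 - s0]).
  by rewrite /= rho0 ltr01 !subr_gt0 az0 bz0 sz0.
have A1 : a < z0.1 - d by clear -da; lra.
have A2 : z0.1 + d < b by clear -db; lra.
have A3 : s0 < z0.2 - d by clear -ds; lra.
have [d0' d0''] : z0.1 - d <= z0.1 /\ z0.1 <= z0.1 + d by clear -d0; split; lra.
have d0t : z0.2 - d <= z0.2 by clear -d0; lra.
have B w : z0.1 - d <= w.1 -> w.1 <= z0.1 + d -> z0.2 - d <= w.2 -> w.2 <= z0.2 ->
    [/\ a < w.1, w.1 < b, s0 < w.2 & w.2 <= s1].
  by move=> w1 w2 w3 w4; split; [exact: lt_le_trans w1|exact: le_lt_trans A2|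
    exact: lt_le_trans w3|exact: le_trans z0s1].
pose C := 1 + sigma ^+ 2 + 2 * `|r - q - sigma ^+ 2 / 2|.
have C1 : 1 <= C by rewrite /C -addrA lerDl addr_ge0 ?sqr_ge0// mulr_ge0.
have rm0 : 0 < r * m by rewrite mulr_gt0.
(* The final contradiction is [r m - k C <= r * W z1 <= r e], in which [k C] and [r e] are at most
   [r m / 4] each. *)
pose k := r * m / (4 * C).
have C0 : 0 < C by exact: lt_le_trans C1.
have k0 : 0 < k by rewrite divr_gt0// mulr_gt0.
have kC : k * C = r * m / 4 by rewrite /k; field; rewrite gt_eqF.
(* Let [g] be the penalty without its factor [k]. From [W z0 <= e] and [W >= - e + k g], the bound
   [e <= k d^2 / 4] forces [g < d^2] at the minimum. As [d < 1], the minimum is then within [d] of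
   [z0] in space and in time. *)
pose e := Num.min (m / 4) (k * d ^+ 2 / 4).
have kd0 : 0 < k * d ^+ 2 by rewrite mulr_gt0// exprn_gt0.
have e0 : 0 < e by rewrite lt_min !divr_gt0.
have em : e <= m / 4 by rewrite /e ge_min lexx.
have ek : e <= k * d ^+ 2 / 4 by rewrite /e ge_min lexx orbT.
have [U [Ux [Uxx [Ut [cU UP]]]]] := rhoP e e0.
pose W w := U w - v w + m + k * ((w.1 - z0.1) ^+ 2 + (z0.2 - w.2)).
have sub w : z0.1 - d <= w.1 -> w.1 <= z0.1 + d -> z0.2 - d <= w.2 -> w.2 <= z0.2 -> square z0 rho w.
  move=> w1 w2 w3 w4; clear -w1 w2 w3 w4 drho d0; apply/boxP; split; lra.
have cW : {within `[z0.1 - d, z0.1 + d] `*` `[z0.2 - d, z0.2], continuous W}.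
  have cg : continuous (fun w => - v w + m + k * ((w.1 - z0.1) ^+ 2 + (z0.2 - w.2))).
    move=> w; apply: cvgD; first by apply: cvgD; [by apply: cvgN; exact: cv|exact: cvg_cst].
    apply: cvgM; first exact: cvg_cst.
    apply: cvgD; last by apply: cvgB; [exact: cvg_cst|exact: cvg_snd].
    apply: (@continuous_comp _ _ _ (fun w : R * R => w.1 - z0.1) (fun x : R => x ^+ 2));
      last exact: exprn_continuous.
    by apply: cvgB; [exact: cvg_fst|exact: cvg_cst].
  have -> : W = U \+ (fun w => - v w + m + k * ((w.1 - z0.1) ^+ 2 + (z0.2 - w.2))).
    by apply/funext => w; rewrite /W /= !addrA.
  move=> w; apply: continuousD; last exact: (continuous_subspaceT cg).
  by apply: continuous_subspaceW cU w => y /boxP[*]; exact: sub.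
have [z1 [z1a z1b z1c z1d z1min]] := box_min (a := z0.1 - d) (b := z0.1 + d)
  (c := z0.2 - d) (d := z0.2) (le_trans d0' d0'') d0t cW.
have Wz0 : W z0 <= e.
  have [_ Uu _] := UP z0 (sub z0 d0' d0'' d0t (lexx _)).
  rewrite /W !subrr expr0n /= addr0 mulr0 addr0 /m.
  rewrite (_ : U z0 - v z0 + (v z0 - u z0) = U z0 - u z0); last by clear; ring.
  exact: le_trans (ler_norm _) Uu.
have Wz1 : W z1 <= e by apply: le_trans Wz0; exact: z1min.
have Wlow w : z0.1 - d <= w.1 -> w.1 <= z0.1 + d -> z0.2 - d <= w.2 -> w.2 <= z0.2 ->
    - e + k * ((w.1 - z0.1) ^+ 2 + (z0.2 - w.2)) <= W w.
  move=> w1 w2 w3 w4; have [_ /ler_normlP[Uu _] _] := UP w (sub w w1 w2 w3 w4).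
  have [/ltW b1 /ltW b2 /ltW b3 b4] := B w w1 w2 w3 w4.
  have := z0min w b1 b2 b3 b4.
  rewrite /W /m; clear -Uu; lra.
have gz1 : (z1.1 - z0.1) ^+ 2 + (z0.2 - z1.2) < d ^+ 2.
  rewrite -(ltr_pM2l k0); have := Wlow z1 z1a z1b z1c z1d.
  clear -Wz1 ek e0 kd0; lra.
have d2d : d ^+ 2 <= d by rewrite expr2 ler_piMr// ltW.
have z1x : `|z1.1 - z0.1| < d.
  rewrite -(ltr_pXn2r (n := 2)) ?nnegrE ?normr_ge0 ?ltW// real_normK ?num_real//.
  clear -gz1 z1d; lra.
have z1t : z0.2 - d < z1.2.
  by have := sqr_ge0 (z1.1 - z0.1); clear -gz1 d2d; lra.
move/ltr_normlP: (z1x) => [z1x1 z1x2].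
have [|d' d'0 /and3P[d'1 d'2 _]] := ex_small (s := [:: d - `|z1.1 - z0.1|; z1.2 - (z0.2 - d)]).
  by rewrite /= !subr_gt0 z1x z1t.
have zN : - (z1.1 - z0.1) <= `|z1.1 - z0.1| by rewrite -normrN ler_norm.
have zP : z1.1 - z0.1 <= `|z1.1 - z0.1| by rewrite ler_norm.
have H : residual sigma r q W (fun w => Ux w - vx w + k * (2 * (w.1 - z0.1)))
    (fun w => Uxx w - vxx w + k * 2)
    (fun w => Ut w - vt w + k * - 1) z1 <= r * W z1.
  apply: (residual_at_min d'0) => w /ltr_normlP[w1 w2] w3 w4.
  have [w5 w6 w7] : [/\ z0.1 - d <= w.1, w.1 <= z0.1 + d & z0.2 - d <= w.2].
    by clear -w1 w2 w3 d'1 d'2 zN zP; split; lra.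
  have w8 : w.2 <= z0.2 by exact: le_trans z1d.
  have [UC _ _] := UP w (sub w w5 w6 w7 w8).
  have [b1 b2 b3 b4] := B w w5 w6 w7 w8.
  have [vC _] := vP w b1 b2 b3 b4.
  by split; [exact: C21_penalized|exact: z1min].
have [_ _ UR] := UP z1 (sub z1 z1a z1b z1c z1d).
have [b1 b2 b3 b4] := B z1 z1a z1b z1c z1d.
have [_ vR] := vP z1 b1 b2 b3 b4.
have := residual_sub_ge m (k := k) (z0 := z0) (z := z1) (ltW (lt_trans z1x d1)) z1d (ltW k0) (ltW r0) UR vR.
move/le_trans => /(_ _ H); rewrite -/C kC.
have : r * W z1 <= r * (m / 4) by rewrite ler_pM2l//; exact: le_trans em.
clear -rm0; lra.
Qed.

End maximum_principle.

(** * Bump functions *)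

Section smooth.
Context {R : realType}.
Implicit Types (f g : R -> R).

Fixpoint smooth (n : nat) f : Prop :=
  if n is m.+1 then (forall x, derivable f x 1) /\ smooth m (derive1 f) else True.

Lemma smoothW n f : smooth n.+1 f -> smooth n f.
Proof. by elim: n f => [//|n IH] f [df sf]; split=> //; exact: IH. Qed.

Lemma smooth_cst n (c : R) : smooth n (cst c).
Proof.
elim: n c => [//|n IH] c; split; first by move=> x; exact: derivable_cst.
suff -> : derive1 (cst c) = cst 0 :> (R -> R) by exact: IH.
by apply/funext => x; rewrite derive1_cst.
Qed.

Lemma smoothD n f g : smooth n f -> smooth n g -> smooth n (fun x => f x + g x).
Proof.
elim: n f g => [//|n IH] f g [df sf] [dg sg]; split.
  by move=> x; apply: derivableD.
suff -> : derive1 (fun x => f x + g x) = fun x => derive1 f x + derive1 g x by exact: IH.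
by apply/funext => x; rewrite !derive1E deriveD.
Qed.

Lemma smoothM n f g : smooth n f -> smooth n g -> smooth n (fun x => f x * g x).
Proof.
elim: n f g => [//|n IH] f g sf sg.
have [[df sf'] [dg sg']] := (sf, sg); split.
  by move=> x; apply: derivableM.
suff -> : derive1 (fun x => f x * g x) = fun x => derive1 f x * g x + f x * derive1 g x.
  by apply: smoothD; apply: IH => //; exact: smoothW.
by apply/funext => x; rewrite !derive1E deriveM// /GRing.scale /=; ring.
Qed.

Lemma smoothZ n f (c : R) : smooth n f -> smooth n (fun x => c * f x).
Proof. by move=> sf; apply: smoothM => //; exact: smooth_cst. Qed.

Lemma smooth_affine n f (b c : R) : smooth n f -> smooth n (fun x => f (b + c * x)).
Proof.
elim: n f => [//|n IH] f [df sf].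
have D (x : R) : is_derive x 1 (fun x => f (b + c * x)) (c * derive1 f (b + c * x)).
  have ? : is_derive (b + c * x) 1 f (derive1 f (b + c * x)).
    by apply: DeriveDef; [exact: df|rewrite derive1E].
  by apply: is_derive_eq; rewrite /GRing.scale /=; ring.
split; first by move=> x; have [] := D x.
suff -> : derive1 (fun x => f (b + c * x)) = fun x => c * derive1 f (b + c * x).
  by apply: smoothZ; exact: IH.
by apply/funext => x; rewrite derive1E; have [] := D x.
Qed.

Lemma smooth_continuous f : smooth 1 f -> continuous f.
Proof. by move=> [df _] x; exact/differentiable_continuous/derivable1_diffP. Qed.

(* This family in [k] is stable under differentiation. *)
Definition flat (k : nat) (x : R) : R := if 0 < x then x ^- k * expR (- x^-1) else 0.

Lemma flat_ge0 k x : 0 <= flat k x.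
Proof.
rewrite /flat; case: ifP => // x0.
by rewrite mulr_ge0 ?expR_ge0// invr_ge0 exprn_ge0// ltW.
Qed.

(** Raise [e^y >= y] with [y = 1 / ((k + 2) x)] to the power [k + 2]. The exponent is two above [k]
    so that a factor [x^2] survives, which makes the derivative at the origin vanish. *)
Lemma flat_le k x : flat k x <= k.+2%:R ^+ k.+2 * x ^+ 2.
Proof.
rewrite /flat; case: ifP => [x0|_]; last by rewrite mulr_ge0 ?sqr_ge0// exprn_ge0.
rewrite mulrC ler_pdivrMr ?exprn_gt0// -mulrA -exprD add2n -exprMn expRN.
have y0 : 0 < k.+2%:R * x by rewrite mulr_gt0.
rewrite -[leRHS]invrK lef_pV2 ?posrE ?expR_gt0 ?invr_gt0 ?exprn_gt0//.
have -> : expR x^-1 = expR ((k.+2%:R * x)^-1) ^+ k.+2.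
  rewrite -expRM_natl; congr expR.
  by rewrite invfM mulrA mulfV ?mul1r.
rewrite -exprVn lerXn2r ?nnegrE ?expR_ge0 ?invr_ge0 ?(ltW y0)//.
by move: (_^-1) => y; have := expR_ge1Dx y; lra.
Qed.

Lemma is_derive_flat k (x : R) :
  is_derive x 1 (flat k) (- k%:R * flat k.+1 x + flat k.+2 x).
Proof.
have [x0|x0|->] := ltgtP x 0.
- have -> : - k%:R * flat k.+1 x + flat k.+2 x = 0.
    by rewrite /flat ltNge (ltW x0) /= mulr0 addr0.
  have := is_derive_cst (0 : R) x 1.
  apply: near_eq_is_derive.
  near=> y; rewrite /flat ifN// -leNgt; apply/ltW.
  by near: y; exact: lt_nbhsl.
- have xn0 : x != 0 by rewrite gt_eqF.
  have xk0 : x ^+ k != 0 by rewrite expf_neq0.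
  have D : is_derive x 1 (fun y => y ^- k * expR (- y^-1))
      (- k%:R * flat k.+1 x + flat k.+2 x).
    have ? := is_deriveV xn0 (is_derive_id x (1 : R)).
    have Dk : is_derive x 1 (fun y : R => y ^+ k) (k%:R * x ^+ k.-1).
      by apply: DeriveDef; [exact: exprn_derivable|rewrite exp_derive /GRing.scale /= mulr1].
    have ? := @is_deriveV _ (fun y => y ^+ k) x _ 1 xk0 Dk.
    apply: is_derive_eq; rewrite /GRing.scale /= /flat x0.
    case: (k) xk0 => [|m] xm0; first by rewrite /= expr0; field.
    by rewrite /= -!natr1 !exprS; field; rewrite expf_neq0.
  apply: near_eq_is_derive D.
  by near=> y; rewrite /flat ifT//; near: y; exact: lt_nbhsr.
- have -> : - k%:R * flat k.+1 0 + flat k.+2 0 = 0 by rewrite /flat ltxx mulr0 addr0.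
  have H : h^-1 *: ((flat k \o shift 0) (h *: 1) - flat k 0) @[h --> 0^'] --> (0 : R).
    apply/cvgrPdist_lt => e e0; pose M : R := k.+2%:R ^+ k.+2.
    have M0 : 0 < M by rewrite exprn_gt0.
    near=> h; rewrite sub0r normrN /= [h *: 1]mulr1 addr0 /flat ltxx subr0 -/(flat k h).
    have h0 : h != 0 by near: h; exact: nbhs_dnbhs_neq.
    rewrite /GRing.scale /= normrM normfV ger0_norm ?flat_ge0//.
    rewrite ltr_pdivrMl ?normr_gt0//.
    apply: (le_lt_trans (flat_le k h)); rewrite -/M -real_normK ?num_real//.
    rewrite expr2 mulrCA ltr_pM2l ?normr_gt0// -ltr_pdivlMl//.
    by near: h; apply: dnbhs0_lt; rewrite mulr_gt0// invr_gt0.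
  split; first by apply/cvg_ex; exists 0.
  exact/cvg_lim.
Unshelve. all: end_near. Qed.

Lemma smooth_flat n k : smooth n (flat k).
Proof.
elim: n k => [//|n IH] k; split; first by move=> x; have [] := is_derive_flat k x.
suff -> : derive1 (flat k) = fun x => - k%:R * flat k.+1 x + flat k.+2 x.
  by apply: smoothD => //; exact: smoothZ.
by apply/funext => x; rewrite derive1E; have [_ ->] := is_derive_flat k x.
Qed.

End smooth.

Section mollifier.
Context {R : realType}.
Implicit Types (f g : R -> R) (d : R).
Notation mu := (@lebesgue_measure R).

(** Sign and total mass are left out, which makes the class closed under differentiation. *)
Definition bump d f := (forall n, smooth n f) /\ forall x, d < `|x| -> f x = 0.

Lemma bump_continuous d f : bump d f -> continuous f.
Proof. by move=> [/(_ 1%N)/smooth_continuous]. Qed.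

Lemma bump_is_derive d f (x : R) : bump d f -> is_derive x 1 f (derive1 f x).
Proof. by move=> [/(_ 1%N)[df _] _]; apply: DeriveDef; [exact: df|rewrite derive1E]. Qed.

Lemma bump_derive1 d f : bump d f -> bump d (derive1 f).
Proof.
move=> [sf f0]; split=> [n|x dx]; first by have [] := sf n.+1.
have D0 : is_derive x 1 f 0.
  apply: near_eq_is_derive (is_derive_cst (0 : R) x 1).
  have /cvgrPdist_lt/(_ (`|x| - d)) H : `|y| @[y --> x] --> `|x| by apply: cvg_norm; exact: cvg_id.
  near=> y; rewrite f0//.
  have : `| `|x| - `|y| | < `|x| - d by near: y; apply: H; rewrite subr_gt0.
  by move/ltr_normlP => [? ?]; lra.
by rewrite derive1E; case: D0.
Unshelve. all: end_near. Qed.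

Lemma bump_bounded d f : 0 <= d -> bump d f -> exists2 M, 0 < M & forall x, `|f x| <= M.
Proof.
move=> d0 bf; have cf : {within `[- d, d], continuous (fun x => `|f x|)}.
  apply: continuous_subspaceT => x; apply: cvg_norm; exact: (bump_continuous bf).
have [c _ cmax] := EVT_max (a := - d) (b := d) ltac:(lra) cf.
exists (`|f c| + 1); first by rewrite ltr_wpDl.
move=> x; have [xd|dx] := lerP `|x| d.
  by rewrite ler_wpDr// cmax// in_itv /= -ler_norml.
by case: bf => _ ->//; rewrite normr0 addr_ge0.
Qed.

Lemma bump_exists d : 0 < d -> exists f, [/\ bump d f, forall x, 0 <= f x &
  (\int[mu]_x (f x)%:E = 1)%E].
Proof.
move=> d0; pose b (x : R) := flat 0 (1 + d^-1 * x) * flat 0 (1 + - d^-1 * x).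
have sb n : smooth n b by apply: smoothM; apply: smooth_affine; exact: smooth_flat.
have b0 x : 0 <= b x by rewrite mulr_ge0// flat_ge0.
have flat1 x : flat 0 x <= (1 : R).
  rewrite /flat; case: ifP => // x0; rewrite expr0 invr1 mul1r -expR0 ler_expR.
  by rewrite oppr_le0 invr_ge0 ltW.
have bd x : d < `|x| -> b x = 0.
  rewrite /b /flat => dx; case: ifP => // h1; last by rewrite mul0r.
  case: ifP => h2; last by rewrite mulr0.
  exfalso; move: dx; apply/negP; rewrite -leNgt ler_norml.
  move: h1 h2; rewrite -(ltr_pM2l d0) mulrDr mulrA mulfV ?gt_eqF// mulr0 mulr1 mul1r => h1.
  rewrite -(ltr_pM2l d0) mulrDr mulNr mulrN mulrA mulfV ?gt_eqF// mulr0 mulr1 mul1r => h2.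
  by apply/andP; split; lra.
have b1 x : b x <= 1 by rewrite -[leRHS]mulr1 ler_pM// flat_ge0.
(* On [[0, d/2]] both factors of [b] have an argument of at least [1/2], where [flat 0] is at least
   [exp(-2)]. This keeps the integral away from zero before normalization. *)
pose c := expR (- 2) * expR (- 2) : R.
have c0 : 0 < c by rewrite mulr_gt0 ?expR_gt0.
have bc x : 0 <= x <= d / 2 -> c <= b x.
  move=> /andP[x0 xd]; have xd2 : 0 <= d^-1 * x <= 1 / 2.
    by rewrite mulr_ge0 ?invr_ge0 ?(ltW d0)//= mulrC ler_pdivrMr//; lra.
  have F y : 1 / 2 <= y -> expR (- 2) <= flat 0 y.
    move=> y2; rewrite /flat ifT; last lra.
    rewrite expr0 invr1 mul1r ler_expR lerN2 -[leRHS]invrK lef_pV2 ?posrE ?invr_gt0//; lra.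
  by rewrite ler_pM ?expR_ge0//; apply: F; lra.
have mbR : measurable_fun [set: measurableTypeR R] b.
  by apply: continuous_measurable_fun; apply: smooth_continuous; exact: sb.
have /measurable_EFinP mb := mbR.
pose I := (\int[mu]_x (b x)%:E)%E.
have Ipos : (c%:E * (d / 2)%:E <= I)%E.
  rewrite (_ : (d / 2)%:E = mu `[0, d / 2]); last first.
    by rewrite lebesgue_measure_itv /= lte_fin ifT ?divr_gt0// oppr0 adde0.
  rewrite -integral_cst//; apply: (@le_trans _ _ (\int[mu]_(x in `[0%R, (d / 2)%R]) (b x)%:E)%E).
    apply: ge0_le_integral => //.
    - by move=> x _; rewrite lee_fin ltW.
    - exact: measurable_funTS.
  by apply: ge0_subset_integral => // x _; rewrite lee_fin.
have Ifin : (I <= (2 * d)%:E)%E.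
  have -> : I = (\int[mu]_(x in `[(- d)%R, d]) (b x)%:E)%E.
    rewrite /I [RHS]integral_mkcond; apply: eq_integral => x _; rewrite patchE.
    case: ifPn => //; rewrite notin_setE /= in_itv /= -ler_norml => /negP.
    by rewrite -ltNge => /bd ->.
  rewrite (_ : (2 * d)%:E = 1%:E * mu `[(- d)%R, d])%E; last first.
    rewrite lebesgue_measure_itv /= lte_fin ifT; last lra.
    by rewrite mul1e -EFinB; congr (_%:E); lra.
  rewrite -integral_cst//; apply: ge0_le_integral => //.
  - by move=> x _; rewrite lee_fin.
  - exact: measurable_funTS.
  - by move=> x _; rewrite lee_fin.
have If : I \is a fin_num.
  by rewrite ge0_fin_numE ?(le_lt_trans Ifin) ?ltry// integral_ge0// => x _; rewrite lee_fin.
have J0 : 0 < fine I.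
  by rewrite -lte_fin fineK// (lt_le_trans _ Ipos)// -EFinM lte_fin !mulr_gt0// divr_gt0.
exists (fun x => (fine I)^-1 * b x); split.
- by split=> [n|x /bd ->]; [exact: smoothZ|rewrite mulr0].
- by move=> x; rewrite mulr_ge0// invr_ge0 ltW.
- under eq_integral do rewrite EFinM.
  rewrite ge0_integralZl//; last by rewrite lee_fin invr_ge0 ltW.
    by rewrite -/I -[I in X in (_ * X)%E]fineK// -EFinM mulVf// gt_eqF.
  by move=> x _; rewrite lee_fin.
Qed.

Lemma integral_shift g (x : R) : continuous g -> (forall y, 0 <= g y) ->
  (\int[mu]_y (g (y - x))%:E = \int[mu]_y (g y)%:E)%E.
Proof.
move=> cg g0.
have D (y : R) : is_derive y 1 (fun y : R => y - x) 1.
  by apply: is_derive_eq; rewrite subr0.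
have D1 : derive1 (fun y : R => y - x) = cst 1.
  by apply/funext => y; rewrite derive1E; case: (D y).
rewrite [RHS](increasing_ge0_integration_by_substitutionT (F := fun y => y - x))//.
- by apply: eq_integral => y _; rewrite D1 /= fctE mulr1.
- by move=> y z; rewrite ltrD2r.
- by rewrite D1; exact: cst_continuous.
- by rewrite D1; exact: is_cvg_cst.
- by rewrite D1; exact: is_cvg_cst.
- by apply: cvg_addrr_Ny.
- by apply: cvg_addrr.
Qed.

End mollifier.

(** * Mollification *)

Section tensor.
Context {R : realType}.
Implicit Types (f u : R * R -> R) (g h : R -> R) (c y z : R * R) (d : R).
Notation leb2 := (@leb2 R).

Definition tensor g h c : R * R -> R := fun y => g (y.1 - c.1) * h (y.2 - c.2).

Lemma tensor_is_derive_x d g h c y : bump d g ->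
  is_derive y.1 1 (fun x => tensor g h c (x, y.2)) (tensor (derive1 g) h c y).
Proof.
move=> bg; have ? := bump_is_derive (y.1 - c.1) bg; rewrite /tensor /=.
by apply: is_derive_eq; rewrite /GRing.scale /=; ring.
Qed.

Lemma tensor_is_derive_t d g h c y : bump d h ->
  is_derive y.2 1 (fun t => tensor g h c (y.1, t)) (tensor g (derive1 h) c y).
Proof.
move=> bh; have ? := bump_is_derive (y.2 - c.2) bh; rewrite /tensor /=.
by apply: is_derive_eq; rewrite /GRing.scale /=; ring.
Qed.

Lemma dx_tensor d g h c : bump d g -> dx (tensor g h c) = tensor (derive1 g) h c.
Proof.
move=> bg; apply/funext => y; rewrite /dx derive1E.
by case: (tensor_is_derive_x h c y bg).
Qed.

Lemma dtau_tensor d g h c : bump d h -> dtau (tensor g h c) = tensor g (derive1 h) c.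
Proof.
move=> bh; apply/funext => y; rewrite /dtau derive1E.
by case: (tensor_is_derive_t g c y bh).
Qed.

Lemma tensor_continuous d g h c : bump d g -> bump d h -> continuous (tensor g h c).
Proof.
move=> bg bh y; apply: cvgM.
  apply: (@continuous_comp _ _ _ (fun y : R * R => y.1 - c.1) g); last exact: (bump_continuous bg).
  by apply: cvgB; [exact: cvg_fst|exact: cvg_cst].
apply: (@continuous_comp _ _ _ (fun y : R * R => y.2 - c.2) h); last exact: (bump_continuous bh).
by apply: cvgB; [exact: cvg_snd|exact: cvg_cst].
Qed.

Lemma tensor_Ck n d g h c : bump d g -> bump d h -> Ck n (tensor g h c).
Proof.
elim: n g h => [|n IH] g h bg bh /=; first exact: tensor_continuous bg bh.
split.
- exact: tensor_continuous bg bh.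
- by move=> z; have [] := tensor_is_derive_x h c z bg.
- by move=> z; have [] := tensor_is_derive_t g c z bh.
- by rewrite (dx_tensor _ _ bg); apply: IH => //; exact: bump_derive1.
- by rewrite (dtau_tensor _ _ bh); apply: IH => //; exact: bump_derive1.
Qed.

Lemma tensor_out d g h c y : bump d g -> bump d h -> ~ square c d y -> tensor g h c y = 0.
Proof.
move=> bg bh yc; rewrite /tensor.
have [y1|y1] := lerP `|y.1 - c.1| d; last by rewrite (proj2 bg) ?mul0r.
have [y2|y2] := lerP `|y.2 - c.2| d; last by rewrite (proj2 bh) ?mulr0.
exfalso; apply: yc; apply/boxP; move: y1 y2; rewrite !ler_norml => /andP[? ?] /andP[? ?].
by split; lra.
Qed.

Lemma tensor_test d g h c (U : set (R * R)) : bump d g -> bump d h ->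
  square c d `<=` U -> test_function U (tensor g h c).
Proof.
move=> bg bh cU; split; first by move=> n; exact: tensor_Ck bg bh.
exists (square c d); split => //; first exact: compact_box.
by move=> z; exact: tensor_out.
Qed.

Lemma tensor_bounded d g h : 0 <= d -> bump d g -> bump d h ->
  exists2 M, 0 < M & forall c y, `|tensor g h c y| <= M.
Proof.
move=> d0 /(bump_bounded d0)[M M0 gM] /(bump_bounded d0)[N N0 hN].
exists (M * N); first exact: mulr_gt0.
by move=> c y; rewrite normrM ler_pM.
Qed.

Lemma measurable_tensor d g h c (D : set (R * R)) : bump d g -> bump d h ->
  measurable_fun D (tensor g h c).
Proof.
move=> bg bh; apply: measurable_funTS; apply: measurable_funM.
  apply: (measurableT_comp (f := g)).
    apply: continuous_measurable_fun; exact: (bump_continuous bg).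
  by apply: measurable_funB; [exact: measurable_fst|exact: measurable_cst].
apply: (measurableT_comp (f := h)).
  apply: continuous_measurable_fun; exact: (bump_continuous bh).
by apply: measurable_funB; [exact: measurable_snd|exact: measurable_cst].
Qed.

Lemma measurable_box (a b a' b' : R) : measurable (`[a, b] `*` `[a', b'] : set (R * R)).
Proof. by apply: measurableX. Qed.

Lemma integrable_tensor d f g h c (K : set (R * R)) : measurable K -> 0 <= d -> bump d g -> bump d h ->
  leb2.-integrable K (EFin \o f) ->
  leb2.-integrable K (EFin \o (fun y => f y * tensor g h c y)).
Proof.
move=> mK d0 bg bh fi; have [M M0 MP] := tensor_bounded d0 bg bh.
have -> : EFin \o (fun y => f y * tensor g h c y) = ((EFin \o f) \* (EFin \o tensor g h c))%E.
  by apply/funext => y; rewrite /= EFinM.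
apply: integrableMl => //; first exact: measurable_tensor bg bh.
exists M; split; first exact: num_real.
by move=> N MN y _ /=; apply: (le_trans (MP c y)); exact: ltW.
Qed.

End tensor.

Lemma Rintegral_is_derive {R : realType} d {T : measurableType d}
    (mu : {measure set T -> \bar R}) (K : set T) (F DF : R -> T -> R) (G : T -> R) (a : R) :
  measurable K -> (forall x, mu.-integrable K (EFin \o F x)) ->
  (forall (x : R) y, is_derive x 1 (F^~ y) (DF x y)) ->
  mu.-integrable K (EFin \o G) -> (forall x y, `|DF x y| <= G y) ->
  is_derive a 1 (fun x => Rintegral mu K (F x)) (Rintegral mu K (DF a)).
Proof.
move=> mK iF dF iG FG.
have dE x y : partial1of2 F x y = DF x y by rewrite partial1of2E; case: (dF x y).
have Ia : `]a - 1, a + 1[%classic a by rewrite /= in_itv /=; apply/andP; split; lra.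
have derF x y : `]a - 1, a + 1[%classic x -> K y -> derivable (F ^~ y) x 1.
  by move=> _ _; case: (dF x y).
have G0 y : 0 <= G y by rewrite (le_trans _ (FG a y)).
have ub x y : `]a - 1, a + 1[%classic x -> K y -> `|partial1of2 F x y| <= G y.
  by move=> _ _; rewrite dE.
apply: DeriveDef.
  exact: (derivable_under_integral mK Ia (fun x _ => iF x) derF G0 iG ub).
rewrite -derive1E (differentiation_under_integral mK Ia (fun x _ => iF x) derF G0 iG ub).
by apply: eq_Rintegral => y _; rewrite dE.
Qed.

Section mollify.
Context {R : realType}.
Implicit Types (f u : R * R -> R) (g h : R -> R) (c y z : R * R) (d : R) (K : set (R * R)).
Notation leb2 := (@leb2 R).

(** The kernel is a function of [y - c], so differentiation in the centre [c] produces a sign; it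
    cancels the sign in the definition of the weak derivative. Integration is over a fixed compact
    [K], where the data are known to be integrable. *)
Definition mollify K f g h c := Rintegral leb2 K (fun y => f y * tensor g h c y).

Lemma integrable_normr K f : measurable K ->
  leb2.-integrable K (EFin \o f) -> leb2.-integrable K (EFin \o (fun y => `|f y|)).
Proof.
move=> mK fi; have -> : EFin \o (fun y => `|f y|) = abse \o (EFin \o f) by [].
exact: integrable_abse.
Qed.

Lemma integrable_scaled_norm K f (M : R) : measurable K ->
  leb2.-integrable K (EFin \o f) -> leb2.-integrable K (EFin \o (fun y => M * `|f y|)).
Proof.
move=> mK fi.
have -> : EFin \o (fun y => M * `|f y|) = (fun y => M%:E * (EFin \o (fun y => `|f y|%R)) y)%E.
  by apply/funext => y; rewrite /= EFinM.
by apply: integrableZl => //; exact: integrable_normr.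
Qed.

Lemma mollify_is_derive_x K d f g h c : measurable K -> 0 <= d -> bump d g -> bump d h ->
  leb2.-integrable K (EFin \o f) ->
  is_derive c.1 1 (fun x => mollify K f g h (x, c.2)) (- mollify K f (derive1 g) h c).
Proof.
move=> mK d0 bg bh fi; have bg' := bump_derive1 bg.
have [M M0 MP] := tensor_bounded d0 bg' bh.
pose F x y := f y * tensor g h (x, c.2) y.
pose DF x y := f y * - tensor (derive1 g) h (x, c.2) y.
have -> : - mollify K f (derive1 g) h c = Rintegral leb2 K (DF c.1).
  rewrite -mulN1r -RintegralZl//; last exact: integrable_tensor bg' bh _.
  by apply: eq_Rintegral => y _; rewrite /DF -surjective_pairing; ring.
apply: (@Rintegral_is_derive _ _ _ leb2 K F DF (fun y => M * `|f y|)) => //.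
- by move=> x; exact: integrable_tensor bg bh _.
- move=> x y; have ? := bump_is_derive (y.1 - x) bg; rewrite /F /DF /tensor /=.
  by apply: is_derive_eq; rewrite /GRing.scale /=; ring.
- exact: integrable_scaled_norm.
- by move=> x y; rewrite normrM normrN mulrC ler_wpM2r.
Qed.

Lemma mollify_is_derive_t K d f g h c : measurable K -> 0 <= d -> bump d g -> bump d h ->
  leb2.-integrable K (EFin \o f) ->
  is_derive c.2 1 (fun t => mollify K f g h (c.1, t)) (- mollify K f g (derive1 h) c).
Proof.
move=> mK d0 bg bh fi; have bh' := bump_derive1 bh.
have [M M0 MP] := tensor_bounded d0 bg bh'.
pose F t y := f y * tensor g h (c.1, t) y.
pose DF t y := f y * - tensor g (derive1 h) (c.1, t) y.
have -> : - mollify K f g (derive1 h) c = Rintegral leb2 K (DF c.2).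
  rewrite -mulN1r -RintegralZl//; last exact: integrable_tensor bg bh' _.
  by apply: eq_Rintegral => y _; rewrite /DF -surjective_pairing; ring.
apply: (@Rintegral_is_derive _ _ _ leb2 K F DF (fun y => M * `|f y|)) => //.
- by move=> x; exact: integrable_tensor bg bh _.
- move=> x y; have ? := bump_is_derive (y.2 - x) bh; rewrite /F /DF /tensor /=.
  by apply: is_derive_eq; rewrite /GRing.scale /=; ring.
- exact: integrable_scaled_norm.
- by move=> x y; rewrite normrM normrN mulrC ler_wpM2r.
Qed.

Lemma bump_lipschitz d g : 0 <= d -> bump d g ->
  exists2 L, 0 < L & forall x y : R, `|g x - g y| <= L * `|x - y|.
Proof.
move=> d0 bg; have [L L0 LP] := bump_bounded d0 (bump_derive1 bg).
exists L => // x y; wlog xy : x y / y <= x.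
  by move=> H; have [/ltW/H//|/H] := ltP y x; rewrite distrC [`|y - x|]distrC.
have dg t : t \in `]y, x[%R -> is_derive t 1 g (derive1 g t).
  by move=> _; exact: bump_is_derive bg.
have [z _ ->] := MVT_segment xy dg (continuous_subspaceT (bump_continuous bg)).
by rewrite normrM ler_wpM2r.
Qed.

Lemma tensor_lipschitz d g h : 0 <= d -> bump d g -> bump d h ->
  exists2 L, 0 < L & forall c c' y,
    `|tensor g h c y - tensor g h c' y| <= L * (`|c.1 - c'.1| + `|c.2 - c'.2|).
Proof.
move=> d0 bg bh.
have [Lg Lg0 LgP] := bump_lipschitz d0 bg; have [Lh Lh0 LhP] := bump_lipschitz d0 bh.
have [Mg Mg0 MgP] := bump_bounded d0 bg; have [Mh Mh0 MhP] := bump_bounded d0 bh.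
exists (Lg * Mh + Mg * Lh); first by rewrite addr_gt0 ?mulr_gt0.
move=> c c' y; rewrite /tensor.
set a := g _; set b := h _; set a' := g _; set b' := h _.
have -> : a * b - a' * b' = (a - a') * b + a' * (b - b') by ring.
rewrite (le_trans (ler_normD _ _))// !normrM.
have h1 : `|a - a'| <= Lg * `|c.1 - c'.1|.
  by apply: (le_trans (LgP _ _)); rewrite (_ : y.1 - c.1 - (y.1 - c'.1) = - (c.1 - c'.1)) ?normrN//; ring.
have h2 : `|b - b'| <= Lh * `|c.2 - c'.2|.
  by apply: (le_trans (LhP _ _)); rewrite (_ : y.2 - c.2 - (y.2 - c'.2) = - (c.2 - c'.2)) ?normrN//; ring.
apply: (@le_trans _ _ (Lg * `|c.1 - c'.1| * Mh + Mg * (Lh * `|c.2 - c'.2|))).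
  by apply: lerD; apply: ler_pM => //; [exact: MhP|exact: MgP].
have : 0 <= Lg * Mh * `|c.2 - c'.2| by rewrite !mulr_ge0// ltW.
have : 0 <= Mg * Lh * `|c.1 - c'.1| by rewrite !mulr_ge0// ltW.
lra.
Qed.

(** Partial derivatives in [c] do not give joint continuity. It comes from the kernel being
    Lipschitz in its centre uniformly in [y], so that the mollification is Lipschitz with a constant
    proportional to the integral of [|f|]. *)
Lemma mollify_continuous K d f g h : measurable K -> 0 <= d -> bump d g -> bump d h ->
  leb2.-integrable K (EFin \o f) -> continuous (mollify K f g h).
Proof.
move=> mK d0 bg bh fi c.
have [L L0 LP] := tensor_lipschitz d0 bg bh.
pose I := Rintegral leb2 K (fun y => `|f y|).
have I0 : 0 <= I by apply: Rintegral_ge0.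
have H c' : `|mollify K f g h c - mollify K f g h c'| <= L * (`|c.1 - c'.1| + `|c.2 - c'.2|) * I.
  rewrite /mollify -RintegralB//; [|exact: integrable_tensor bg bh _..].
  set D := L * _.
  have ifD : leb2.-integrable K (EFin \o (fun y => f y * tensor g h c y - f y * tensor g h c' y)).
    have -> : EFin \o (fun y => f y * tensor g h c y - f y * tensor g h c' y) =
      ((EFin \o (fun y => (f y * tensor g h c y)%R)) \- (EFin \o (fun y => (f y * tensor g h c' y)%R)))%E by [].
    by apply: integrableB => //; exact: integrable_tensor bg bh _.
  have H0 := @le_normr_Rintegral _ _ R leb2 K (fun y => f y * tensor g h c y - f y * tensor g h c' y) mK ifD; apply: (le_trans H0).
  have -> : D * I = Rintegral leb2 K (fun y => D * `|f y|).
    by rewrite RintegralZl//; exact: integrable_normr.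
  apply: le_Rintegral => //.
  - exact: (@integrable_normr K (fun y => f y * tensor g h c y - f y * tensor g h c' y)).
  - exact: integrable_scaled_norm.
  - by move=> y _; rewrite -mulrBr normrM mulrC ler_wpM2r.
apply/cvgrPdist_lt => e e0.
have [r r0 <-] : exists2 r, 0 < r & L * (2 * r) * (I + 1) = e.
  exists (e / (2 * L * (I + 1))); first by rewrite divr_gt0// !mulr_gt0// ltr_wpDl.
  by field; apply/andP; split; lra.
apply: (iffRL (@nbhs_ballP R (R * R)%type c _)); exists r => // c' [/= c1 c2].
apply: (le_lt_trans (H c')).
move: c1 c2; rewrite /ball /= => c1 c2.
have : L * (`|c.1 - c'.1| + `|c.2 - c'.2|) * I <= L * (2 * r) * I.
  by rewrite ler_wpM2r// ler_pM2l//; lra.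
move/le_lt_trans; apply.
by rewrite ltr_pM2l ?mulr_gt0//; lra.
Qed.

End mollify.

Section approximation.
Context {R : realType}.
Implicit Types (f u v : R * R -> R) (g h : R -> R) (c y z : R * R) (d : R) (K U : set (R * R)).
Notation mu := (@lebesgue_measure R).
Notation leb2 := (@leb2 R).

(** A form of Heine's theorem in which only [z] ranges over the compact square, while [y] may lie
    outside it. *)
Lemma uniform_continuity_square z0 rho v e : continuous v -> 0 < e ->
  exists2 d, 0 < d & forall z y, square z0 rho z -> square z d y -> `|v y - v z| <= e.
Proof.
move=> cv e0.
pose P (d : R) z := forall y, square z d y -> `|v y - v z| <= e.
have cK : compact (square z0 rho) by exact: compact_box.
have /compact_near_coveringP/(_ R (0^'+) P _) H := cK.
have {}H : \forall d \near 0^'+, square z0 rho `<=` P d.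
  apply: H => z _; have [d d0 dP] := continuous_square z cv (e := e / 2) ltac:(lra).
  exists ([set w | `|w.1 - z.1| < d / 2 /\ `|w.2 - z.2| < d / 2], [set t | t < d / 2]).
    split => /=.
      apply: (iffRL (@nbhs_ballP R (R * R)%type z _)); exists (d / 2); first by rewrite /=; lra.
      by move=> w [/= w1 w2]; split; rewrite distrC.
    by apply: nbhs_right_lt; lra.
  move=> [w t] [/= [/ltr_normlP[w1 w2] /ltr_normlP[w3 w4]] td] y /boxP[y1 y2 y3 y4].
  have A : `|v w - v z| < e / 2 by apply: dP; apply/ltr_normlP; split; lra.
  have B : `|v y - v z| < e / 2 by apply: dP; apply/ltr_normlP; split; lra.
  move: A B => /ltr_normlP[? ?] /ltr_normlP[? ?]; apply/ler_normlP; split; lra.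
have H0 : \forall d \near 0^'+, (0 : R) < d by exact: nbhs_right_gt.
near (0 : R)^'+ => d.
exists d; first by near: d.
have Kd : square z0 rho `<=` P d by near: d.
by move=> z y /Kd; apply.
Unshelve. all: end_near. Qed.

Lemma Rintegral_tensor_sub U K f d g h c : bump d g -> bump d h ->
  square c d `<=` K -> K `<=` U ->
  Rintegral leb2 U (fun y => f y * tensor g h c y) = mollify K f g h c.
Proof.
move=> bg bh cK KU; rewrite /mollify Rintegral_mkcond [RHS]Rintegral_mkcond.
congr (Rintegral _ _ _); apply/funext => y; rewrite !patchE.
have [yK|yK] := pselect (K y); first by rewrite !ifT ?inE//; exact: KU.
rewrite [in RHS]ifF; last by apply/negP; rewrite inE.
by case: ifP => // _; rewrite (tensor_out bg bh) ?mulr0// => /cK.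
Qed.

Lemma mollify_weak U K k (D : (R * R -> R) -> R * R -> R) u w d g h g' h' c :
  weak_derivative U D k u w -> bump d g -> bump d h -> bump d g' -> bump d h' ->
  square c d `<=` K -> K `<=` U -> D (tensor g h c) = tensor g' h' c ->
  mollify K u g' h' c = (-1) ^+ k * mollify K w g h c.
Proof.
move=> [_ _ W] bg bh bg' bh' cK KU DE.
rewrite -(Rintegral_tensor_sub u bg' bh' cK KU) -(Rintegral_tensor_sub w bg bh cK KU).
by rewrite -DE; apply: W; apply: (tensor_test bg bh); exact: (subset_trans cK KU).
Qed.

Lemma integral_tensor K d g c : bump d g -> (forall x, 0 <= g x) ->
  (\int[mu]_x (g x)%:E = 1)%E -> square c d `<=` K ->
  Rintegral leb2 K (tensor g g c) = 1.
Proof.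
move=> bg g0 g1 cK; rewrite Rintegral_mkcond.
have -> : (tensor g g c) \_ K = tensor g g c.
  apply/funext => y; rewrite patchE; case: ifPn => //; rewrite notin_setE => yK.
  by rewrite (tensor_out bg bg)// => /cK.
have cg := bump_continuous bg.
rewrite /Rintegral (@fubini_tonelli1 _ _ _ _ _ mu mu (EFin \o tensor g g c)); last 2 first.
- by apply/measurable_EFinP; have H := @measurable_tensor _ _ g g c setT bg bg; exact: H.
- by move=> y; rewrite lee_fin mulr_ge0.
rewrite /fubini_F.
under eq_integral => x _.
  rewrite /tensor /=; under eq_integral do rewrite EFinM.
  rewrite ge0_integralZl//; last 3 first.
  - apply/measurable_EFinP; apply: (measurableT_comp (f := g)).
      exact: continuous_measurable_fun.
    by apply: measurable_funB; [exact: measurable_id|exact: measurable_cst].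
  - by move=> y _; rewrite lee_fin.
  - by rewrite lee_fin.
  rewrite integral_shift// g1 mule1; over.
by rewrite integral_shift// g1.
Qed.

Lemma mollifyD K d f1 f2 g h c : measurable K -> 0 <= d -> bump d g -> bump d h ->
  leb2.-integrable K (EFin \o f1) -> leb2.-integrable K (EFin \o f2) ->
  mollify K (fun y => f1 y + f2 y) g h c = mollify K f1 g h c + mollify K f2 g h c.
Proof.
move=> mK d0 bg bh i1 i2; rewrite /mollify -RintegralD//; [|exact: integrable_tensor bg bh _..].
by apply: eq_Rintegral => y _; rewrite mulrDl.
Qed.

Lemma mollifyZ K d f (a : R) g h c : measurable K -> 0 <= d -> bump d g -> bump d h ->
  leb2.-integrable K (EFin \o f) ->
  mollify K (fun y => a * f y) g h c = a * mollify K f g h c.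
Proof.
move=> mK d0 bg bh i1; rewrite /mollify -RintegralZl//; last exact: integrable_tensor bg bh _.
by apply: eq_Rintegral => y _; rewrite mulrA.
Qed.

Lemma mollify_ge0 K d f g c : measurable K -> 0 <= d -> bump d g -> (forall x, 0 <= g x) ->
  leb2.-integrable K (EFin \o f) -> {ae leb2, forall y, K y -> 0 <= f y} ->
  0 <= mollify K f g g c.
Proof.
move=> mK d0 bg g0 fi [N [mN N0 NP]]; rewrite /mollify /Rintegral.
rewrite (@negligible_integral _ _ R leb2 K N _ mN mK (integrable_tensor c mK d0 bg bg fi) N0).
apply: fine_ge0; apply: integral_ge0 => y [Ky Ny]; rewrite lee_fin mulr_ge0//; last first.
  by rewrite mulr_ge0.
have [//|fy] := pselect (0 <= f y).
by exfalso; apply: Ny; apply: NP => /= /(_ Ky).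
Qed.

(** The kernel is nonnegative of mass one, so that the constant [v c] is its own mollification and
    the difference is an average of [v y - v c] over the support. *)
Lemma mollify_dist K d v g c e : measurable K -> 0 <= d -> bump d g -> (forall x, 0 <= g x) ->
  (\int[mu]_x (g x)%:E = 1)%E -> square c d `<=` K ->
  leb2.-integrable K (EFin \o v) -> leb2.-integrable K (EFin \o cst 1) ->
  (forall y, square c d y -> `|v y - v c| <= e) -> `|mollify K v g g c - v c| <= e.
Proof.
move=> mK d0 bg g0 g1 cK vi i1 ve.
have I1 (a : R) : mollify K (fun y => a * cst 1 y) g g c = a.
  rewrite (mollifyZ _ _ mK d0 bg bg)//.
  rewrite [X in a * X](_ : _ = 1) ?mulr1// -[RHS](integral_tensor bg g0 g1 cK).
  by apply: eq_Rintegral => y _; rewrite mul1r.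
have iZ (a : R) : leb2.-integrable K (EFin \o (fun y => a * cst 1 y)).
  have -> : EFin \o (fun y : R * R => a * cst 1 y) = (fun y => a%:E * (EFin \o cst 1%R) y)%E.
    by apply/funext => y; rewrite /= EFinM.
  exact: integrableZl.
have E : mollify K v g g c - v c = mollify K (fun y => v y + (- v c) * cst 1 y) g g c.
  by rewrite (mollifyD _ mK d0 bg bg)// I1.
have iD : leb2.-integrable K (EFin \o (fun y => v y + (- v c) * cst 1 y)).
  have -> : EFin \o (fun y => v y + (- v c) * cst 1 y) =
     ((EFin \o v) \+ (EFin \o (fun y => ((- v c) * cst 1 y)%R)))%E by [].
  exact: integrableD.
rewrite E /mollify.
apply: (le_trans (@le_normr_Rintegral _ _ R leb2 K (fun y => (v y + (- v c) * cst 1 y) * tensor g g c y)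
   mK (integrable_tensor c mK d0 bg bg iD))).
rewrite -[leRHS](I1 e); apply: le_Rintegral => //.
- exact: (@integrable_normr _ K (fun y => (v y + (- v c) * cst 1 y) * tensor g g c y) mK (integrable_tensor c mK d0 bg bg iD)).
- exact: (integrable_tensor c mK d0 bg bg (iZ e)).
- move=> y Ky; rewrite normrM /= mulr1 mulr1.
  have t0 : 0 <= tensor g g c y by rewrite mulr_ge0.
  rewrite (ger0_norm t0); have [yd|yd] := pselect (square c d y).
    by rewrite ler_wpM2r// ve.
  by rewrite (tensor_out bg bg yd) !mulr0.
Qed.

End approximation.

(** * From weak derivatives to supersolutions *)

Section weak_supersolution.
Context {R : realType}.
Variables (sigma r q : R).
Implicit Types (f u v : R * R -> R) (c y z : R * R) (K U : set (R * R)).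
Notation mu := (@lebesgue_measure R).
Notation leb2 := (@leb2 R).

Lemma integrable_cst_square z0 rho : leb2.-integrable (square z0 rho) (EFin \o cst 1).
Proof.
apply/integrableP; split; first by apply/measurable_EFinP; exact: measurable_cst.
under eq_integral do rewrite /= normr1.
rewrite integral_cst; last exact: measurable_box.
rewrite mul1e; suff : (leb2 (square z0 rho) < +oo)%E by [].
have -> : leb2 (square z0 rho) =
    (mu `[(z0.1 - rho)%R, (z0.1 + rho)%R] * mu `[(z0.2 - rho)%R, (z0.2 + rho)%R])%E.
  by apply: product_measure1E.
rewrite !lebesgue_measure_itv /=.
by case: ifP => _; case: ifP => _; rewrite ?mul0e ?mule0 ?ltry// -?EFinB -?EFinM ltry.
Qed.

Lemma integrable_eq_on K f g : leb2.-integrable K (EFin \o f) ->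
  measurable K -> (forall z, K z -> f z = g z) -> leb2.-integrable K (EFin \o g).
Proof.
move=> fi mK fg; apply: eq_integrable fi => // z; rewrite inE => Kz.
by rewrite /= fg.
Qed.

Lemma integrable_lincomb K f g (a : R) : measurable K ->
  leb2.-integrable K (EFin \o f) -> leb2.-integrable K (EFin \o g) ->
  leb2.-integrable K (EFin \o (fun z => f z + a * g z)).
Proof.
move=> mK fi gi.
have -> : EFin \o (fun z => f z + a * g z) =
    ((EFin \o f) \+ (fun z => a%:E * (EFin \o g) z))%E.
  by apply/funext => z; rewrite /= EFinD EFinM.
by apply: integrableD => //; exact: integrableZl.
Qed.

Lemma ae_leb2S (P Q : R * R -> Prop) : (forall z, P z -> Q z) ->
  {ae leb2, forall z, P z} -> {ae leb2, forall z, Q z}.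
Proof. by move=> PQ [N [mN N0 NP]]; exists N; split=> // z /= nQ; apply: NP => /= /PQ. Qed.

(** Constant coefficients make [P] commute with mollification, and a nonnegative kernel preserves
    the almost everywhere sign of the residual. Kernels of radius at most [rho / 2] stay in the
    large square when centred in the half square, whose size does not depend on [e], as
    [supersol_at] requires. The sign conditions come last as implications, so that one construction
    serves both the inequality and the equation. *)
Lemma weak_approximation U u ux uxx ut v z0 rho e :
  0 < rho -> 0 < e -> square z0 rho `<=` U -> continuous v ->
  (forall z, U z -> v z = u z) ->
  weak_derivative U (@dx R) 1 u ux ->
  weak_derivative U (@dx R \o @dx R) 2 u uxx ->
  weak_derivative U (@dtau R) 1 u ut ->
  exists V Vx Vxx Vt : R * R -> R,
    [/\ continuous V, forall c, C21_at V Vx Vxx Vt c,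
      forall c, square z0 (rho / 2) c -> `|V c - v c| <= e,
      {ae leb2, forall z, square z0 rho z -> 0 <= ut z - Lop sigma r q (u z) (ux z) (uxx z)} ->
      forall c, square z0 (rho / 2) c -> 0 <= residual sigma r q V Vx Vxx Vt c &
      {ae leb2, forall z, square z0 rho z -> ut z - Lop sigma r q (u z) (ux z) (uxx z) = 0} ->
      forall c, square z0 (rho / 2) c -> residual sigma r q V Vx Vxx Vt c = 0].
Proof.
move=> rho0 e0 KU cv vu wx wxx wt.
pose K := square z0 rho.
have mK : measurable K by exact: measurable_box.
have cK : compact K by exact: compact_box.
have [d1 d10 d1P] := uniform_continuity_square z0 rho cv e0.
pose d := Num.min d1 (rho / 2).
have d0 : 0 < d by rewrite lt_min d10 divr_gt0.
have dd1 : d <= d1 by rewrite /d ge_min lexx.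
have drho : d <= rho / 2 by rewrite /d ge_min lexx orbT.
have [g [bg g0 g1]] := bump_exists d0.
have bg' := bump_derive1 bg; have bg'' := bump_derive1 bg'.
have [iu iux] : leb2.-integrable K (EFin \o u) /\ leb2.-integrable K (EFin \o ux).
  by case: wx => [/(_ K cK KU) ? /(_ K cK KU) ?].
have iuxx : leb2.-integrable K (EFin \o uxx) by case: wxx => _ /(_ K cK KU).
have iut : leb2.-integrable K (EFin \o ut) by case: wt => _ /(_ K cK KU).
have iv : leb2.-integrable K (EFin \o v).
  by apply: integrable_eq_on iu mK _ => z /KU/vu.
have vuE a b c : mollify K v a b c = mollify K u a b c.
  by apply: eq_Rintegral => z; rewrite inE => /KU/vu ->.
have dW : 0 <= d by exact: ltW.
exists (mollify K v g g), (fun c => - mollify K v (derive1 g) g c),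
  (mollify K v (derive1 (derive1 g)) g), (fun c => - mollify K v g (derive1 g) c).
have inK c : square z0 (rho / 2) c -> square c d `<=` K.
  by move=> /boxP[? ? ? ?] y /boxP[? ? ? ?]; apply/boxP; split; lra.
pose res z := ut z - Lop sigma r q (u z) (ux z) (uxx z).
have resE : res = fun z => ((ut z + (- (sigma ^+ 2 / 2)) * uxx z) +
    (- (r - q - sigma ^+ 2 / 2)) * ux z) + r * u z.
  by apply/funext => z; rewrite /res /Lop; ring.
have i1 := integrable_lincomb (- (sigma ^+ 2 / 2)) mK iut iuxx.
have i2 := integrable_lincomb (- (r - q - sigma ^+ 2 / 2)) mK i1 iux.
have ires : leb2.-integrable K (EFin \o res).
  by rewrite resE; exact: (integrable_lincomb r mK i2 iu).
have iZ (a : R) f : leb2.-integrable K (EFin \o f) -> leb2.-integrable K (EFin \o (fun z => a * f z)).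
  move=> fi; have -> : EFin \o (fun z => a * f z) = (fun z => a%:E * (EFin \o f) z)%E.
    by apply/funext => z; rewrite /= EFinM.
  exact: integrableZl.
(* Commutation of [P] with mollification: every derivative is moved from the kernel to the weak
   derivative. *)
have RE c : square z0 (rho / 2) c ->
   residual sigma r q (mollify K v g g) (fun c => - mollify K v (derive1 g) g c)
     (mollify K v (derive1 (derive1 g)) g) (fun c => - mollify K v g (derive1 g) c) c =
   mollify K res g g c.
  move=> /inK cdK; rewrite /residual /Lop !vuE.
  rewrite (mollify_weak (d := d) wx bg bg bg' bg cdK KU); last exact: dx_tensor bg.
  rewrite (mollify_weak (d := d) wxx bg bg bg'' bg cdK KU); last first.
    by rewrite /= (dx_tensor _ _ bg) (dx_tensor _ _ bg').
  rewrite (mollify_weak (d := d) wt bg bg bg bg' cdK KU); last exact: dtau_tensor bg.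
  rewrite resE (mollifyD c mK dW bg bg i2 (iZ _ _ iu)).
  rewrite (mollifyD c mK dW bg bg i1 (iZ _ _ iux)).
  rewrite (mollifyD c mK dW bg bg iut (iZ _ _ iuxx)).
  by rewrite !(mollifyZ _ c mK dW bg bg)//; ring.
split.
- exact: (mollify_continuous mK dW bg bg iv).
- move=> c; split.
  + exact: (mollify_is_derive_x c mK dW bg bg iv).
  + have := mollify_is_derive_x c mK dW bg' bg iv; move/is_deriveN.
    by rewrite opprK.
  + exact: (mollify_is_derive_t c mK dW bg bg iv).
- move=> c cs; apply: (mollify_dist mK dW bg g0 g1 (inK c cs) iv (integrable_cst_square _ _)).
  move=> y /boxP[? ? ? ?]; apply: d1P; last by apply/boxP; split; lra.
  by move: cs => /boxP[? ? ? ?]; apply/boxP; split; lra.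
- by move=> res0 c cs; rewrite RE//; exact: mollify_ge0 bg g0 ires _.
- move=> res0 c cs; rewrite RE//; apply/eqP; rewrite eq_le; apply/andP; split.
    rewrite -oppr_ge0 -mulN1r -(mollifyZ _ c mK dW bg bg ires).
    apply: (mollify_ge0 c mK dW bg g0 (iZ _ _ ires)).
    by apply: ae_leb2S res0 => z H Kz; rewrite /res H// mulr0.
  apply: (mollify_ge0 c mK dW bg g0 ires).
  by apply: ae_leb2S res0 => z H Kz; rewrite /res H.
Qed.

Lemma weak_supersol_at U u ux uxx ut v z0 rho :
  0 < rho -> square z0 rho `<=` U -> continuous v ->
  (forall z, U z -> v z = u z) ->
  weak_derivative U (@dx R) 1 u ux ->
  weak_derivative U (@dx R \o @dx R) 2 u uxx ->
  weak_derivative U (@dtau R) 1 u ut ->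
  {ae leb2, forall z, square z0 rho z -> 0 <= ut z - Lop sigma r q (u z) (ux z) (uxx z)} ->
  supersol_at sigma r q v z0.
Proof.
move=> rho0 KU cv vu wx wxx wt ae0; exists (rho / 2); first by rewrite divr_gt0.
move=> e e0; have [V [Vx [Vxx [Vt [cV CV Vv resV _]]]]] :=
  weak_approximation rho0 e0 KU cv vu wx wxx wt.
exists V, Vx, Vxx, Vt; split; first exact: continuous_subspaceT.
by move=> c cs; split; [exact: CV|exact: Vv|exact: resV].
Qed.

Lemma weak_sol_at U u ux uxx ut v z0 rho :
  0 < rho -> square z0 rho `<=` U -> continuous v ->
  (forall z, U z -> v z = u z) ->
  weak_derivative U (@dx R) 1 u ux ->
  weak_derivative U (@dx R \o @dx R) 2 u uxx ->
  weak_derivative U (@dtau R) 1 u ut ->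
  {ae leb2, forall z, square z0 rho z -> ut z - Lop sigma r q (u z) (ux z) (uxx z) = 0} ->
  supersol_at sigma r q (\- v) z0.
Proof.
move=> rho0 KU cv vu wx wxx wt ae0; exists (rho / 2); first by rewrite divr_gt0.
move=> e e0; have [V [Vx [Vxx [Vt [cV CV Vv _ resV]]]]] :=
  weak_approximation rho0 e0 KU cv vu wx wxx wt.
exists (\- V), (\- Vx), (\- Vxx), (\- Vt); split.
  by apply: continuous_subspaceT => z; apply: continuousN; exact: cV.
move=> c cs; split.
- by have [? ? ?] := CV c; split; exact: is_deriveN.
- by rewrite /= -opprD normrN; exact: Vv.
- by have := resV ae0 c cs; rewrite /residual /Lop /=; lra.
Qed.

End weak_supersolution.

(** * The obstacle problem *)

Section extension.
Context {R : realType}.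
Variables (K1 k1 K2 sigma r q T : R).
Notation psi := (psi1 K1 k1 K2).

(** All that is used about [Y] from here on. The two differential properties stop short of time [T],
    whereas the pointwise bounds and boundary values hold on the closed strip. *)
Record obstacle_solution (y : R * R -> R) : Prop := {
  os_continuous : continuous y;
  os_bounded : exists M, forall z, `|y z| <= M;
  os_super : forall z, z.1 < ln k1 -> 0 < z.2 -> z.2 < T -> supersol_at sigma r q y z;
  os_sub : forall z, z.1 < ln k1 -> 0 < z.2 -> z.2 < T -> psi z.1 < y z ->
    supersol_at sigma r q (\- y) z;
  os_ge : forall z, z.1 <= ln k1 -> 0 <= z.2 -> z.2 <= T -> psi z.1 <= y z;
  os_init : forall x, x <= ln k1 -> y (x, 0) = psi x;
  os_lateral : forall s, 0 <= s -> s <= T -> y (ln k1, s) = K2 - K1 }.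

(* Precomposition with the retraction onto [Qclosure] makes [Y] continuous on
   the whole plane. *)
Definition clamp (z : R * R) : R * R := (Num.min z.1 (ln k1), Num.max 0 (Num.min z.2 T)).

Lemma clampE z : z.1 <= ln k1 -> 0 <= z.2 -> z.2 <= T -> clamp z = z.
Proof.
move=> z1 z2 z3; rewrite /clamp min_l// min_l// max_r//.
by rewrite -surjective_pairing.
Qed.

Lemma min_dist (a b c : R) : `|Num.min a c - Num.min b c| <= `|a - b|.
Proof.
have H := ler_norm (a - b); have H' := ler_norm (- (a - b)); rewrite normrN in H'.
by apply/ler_normlP; have [?|?] := leP a c; have [?|?] := leP b c; split; lra.
Qed.

Lemma max_dist (a b c : R) : `|Num.max c a - Num.max c b| <= `|a - b|.
Proof.
have H := ler_norm (a - b); have H' := ler_norm (- (a - b)); rewrite normrN in H'.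
by apply/ler_normlP; have [?|?] := leP c a; have [?|?] := leP c b; split; lra.
Qed.

Lemma clamp_dist1 z w : `|(clamp z).1 - (clamp w).1| <= `|z.1 - w.1|.
Proof. exact: min_dist. Qed.

Lemma clamp_dist2 z w : `|(clamp z).2 - (clamp w).2| <= `|z.2 - w.2|.
Proof. exact: le_trans (max_dist _ _ _) (min_dist _ _ _). Qed.

Lemma Qclosure_clamp z : 0 <= T -> Qclosure k1 T (clamp z).
Proof.
move=> T0; rewrite /Qclosure /clamp /=; split; first by rewrite ge_min lexx orbT.
by rewrite le_max lexx /= ge_max T0 ge_min lexx orbT.
Qed.

Lemma continuous_clamp (Y : R * R -> R) : 0 <= T ->
  {within Qclosure k1 T, continuous Y} -> continuous (Y \o clamp).
Proof.
move=> T0 /subspace_continuousP cY z; apply/cvgrPdist_lt => e e0.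
have /cvgrPdist_lt/(_ e e0) := cY _ (Qclosure_clamp z T0).
rewrite /within /= => /nbhs_ballP[d d0 dP].
apply: (iffRL (@nbhs_ballP R (R * R)%type z _)); exists d => // w [w1 w2].
apply: dP; last exact: Qclosure_clamp.
by split; rewrite /ball /=; [apply: le_lt_trans w1; exact: clamp_dist1|
  apply: le_lt_trans w2; exact: clamp_dist2].
Qed.

Lemma psi1_continuous : continuous psi.
Proof.
move=> x; rewrite /psi1.
under eq_fun do rewrite maxr_absE.
apply: cvgB; last exact: cvg_cst.
apply: cvgD; last exact: cvg_cst.
have H : expR y - K1 @[y --> x] --> expR x - K1.
  by apply: cvgB; [exact: continuous_expR|exact: cvg_cst].
apply: cvgM; last exact: cvg_cst.
apply: cvgD; first by apply: cvgD => //; exact: cvg_cst.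
by apply: cvg_norm; apply: cvgB => //; exact: cvg_cst.
Qed.

Lemma psi1_lnk1 : 0 < K1 -> K1 < k1 -> psi (ln k1) = K2 - K1.
Proof.
move=> ? ?; rewrite /psi1 lnK ?posrE; last lra.
by rewrite max_l; lra.
Qed.

Lemma strong_solution_obstacle p (Y : R * R -> R) :
  0 < K1 -> K1 < k1 -> 0 < T ->
  bounded_strong_solution K1 k1 K2 sigma r q T p Y ->
  obstacle_solution (Y \o clamp).
Proof.
move=> K10 K1k1 T0 [[[Yx [Yxx [Yt [[cY wx wxx wt _] aeG aeE]]]] [Yge Yinit Ylat]] Ybd].
have cy := continuous_clamp (ltW T0) cY.
have yE z : Qinterior k1 T z -> (Y \o clamp) z = Y z.
  move=> [z1 /andP[z2 z3]] /=; rewrite clampE//; exact: ltW.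
have lat s : 0 <= s -> s <= T -> Y (clamp (ln k1, s)) = K2 - K1.
  by move=> s0 sT; rewrite clampE//= Ylat// s0.
have init x : x <= ln k1 -> Y (clamp (x, 0)) = psi x.
  rewrite le_eqVlt => /predU1P[->|xk]; first by rewrite lat ?psi1_lnk1// ltW.
  by rewrite clampE//= ?Yinit// ltW.
have ge z : z.1 <= ln k1 -> 0 <= z.2 -> z.2 <= T -> psi z.1 <= Y (clamp z).
  case: z => x s /=; rewrite le_eqVlt => /predU1P[->|xk] s0 sT.
    by rewrite lat// psi1_lnk1.
  move: s0; rewrite le_eqVlt => /predU1P[<-|s0]; first by rewrite init// ltW.
  rewrite (@clampE (x, s))//=; [|exact: ltW|exact: ltW].
  by apply: (Yge (x, s)); split => //=; rewrite s0.
have sq z : z.1 < ln k1 -> 0 < z.2 -> z.2 < T ->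
    exists2 rho, 0 < rho & square z rho `<=` Qinterior k1 T.
  move=> z1 z2 z3; pose m := Num.min (ln k1 - z.1) (Num.min z.2 (T - z.2)).
  have m0 : 0 < m by rewrite !lt_min z2 /= !subr_gt0 z1.
  have m1 : m <= ln k1 - z.1 by rewrite /m ge_min lexx.
  have m2 : m <= z.2 by rewrite /m !ge_min lexx ?orbT.
  have m3 : m <= T - z.2 by rewrite /m !ge_min lexx ?orbT.
  exists (m / 2); first lra.
  by move=> w /boxP[? ? ? ?]; split; [lra|apply/andP; split; lra].
split.
- exact: cy.
- move: Ybd => [M [_ MP]]; exists (M + 1) => z.
  by apply: (MP (M + 1)); [rewrite ltrDl|exact: Qclosure_clamp (ltW T0)].
- move=> z z1 z2 z3; have [rho rho0 rhoQ] := sq z z1 z2 z3.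
  apply: (weak_supersol_at rho0 rhoQ cy yE wx wxx wt).
  apply: ae_leb2S aeG => w H /rhoQ[w1 /andP[w2 w3]]; apply: H; split => //.
  by rewrite w2 ltW.
- move=> z z1 z2 z3 zc; have [rho rho0 rhoQ] := sq z z1 z2 z3.
  (* By continuity the strict inequality with the obstacle persists on a smaller square, where the
     almost everywhere equation applies. *)
  have cd : continuous (fun w => (Y \o clamp) w - psi w.1).
    move=> w; apply: cvgB; first exact: cy.
    by apply: (@continuous_comp _ _ _ fst psi); [exact: cvg_fst|exact: psi1_continuous].
  have [d d0 dP] := continuous_square z cd (e := (Y \o clamp) z - psi z.1) ltac:(rewrite subr_gt0; exact: zc).
  pose rho' := Num.min rho (d / 2).
  have rho'0 : 0 < rho' by rewrite lt_min rho0 divr_gt0.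
  have r1 : rho' <= rho by rewrite /rho' ge_min lexx.
  have r2 : rho' <= d / 2 by rewrite /rho' ge_min lexx orbT.
  have sub : square z rho' `<=` Qinterior k1 T.
    by apply: subset_trans rhoQ; apply: square_subset; rewrite subrr normr0; lra.
  apply: (weak_sol_at rho'0 sub cy yE wx wxx wt).
  apply: ae_leb2S aeE => w H ws; have [w1 /andP[w2 w3]] := sub _ ws.
  apply: H; first by split => //; rewrite w2 ltW.
  rewrite -yE; last by split => //; rewrite w2.
  have : `|(Y \o clamp) w - psi w.1 - ((Y \o clamp) z - psi z.1)| < (Y \o clamp) z - psi z.1.
    by move: ws => /boxP[? ? ? ?]; apply: dP; apply/ltr_normlP; split; lra.
  by move=> /ltr_normlP[+ _]; rewrite -[in _ < (Y \o clamp) w]subr_gt0; lra.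
- exact: ge.
- exact: init.
- exact: lat.
Qed.

End extension.

(** * Barriers *)

Section barriers.
Context {R : realType}.
Variables (sigma r q : R).
Implicit Types (u v : R * R -> R) (z w : R * R).

Lemma continuous_shift u (h : R) : continuous u -> continuous (fun w => u (w.1, w.2 + h)).
Proof.
move=> cu w; apply/cvgrPdist_lt => e e0.
have [d d0 dP] := continuous_square (w.1, w.2 + h) cu e0.
apply: (iffRL (@nbhs_ballP R (R * R)%type w _)); exists d => // w' [w1 w2].
rewrite distrC; apply: dP => /=; first by rewrite distrC.
by rewrite (_ : w'.2 + h - (w.2 + h) = - (w.2 - w'.2)) ?normrN//; ring.
Qed.

Lemma supersol_at_shift u (h : R) z : supersol_at sigma r q u (z.1, z.2 + h) ->
  supersol_at sigma r q (fun w => u (w.1, w.2 + h)) z.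
Proof.
move=> [rho rho0 H]; exists rho => // e e0.
have [U [Ux [Uxx [Ut [cU UP]]]]] := H e e0.
have sh w : square z rho w -> square (z.1, z.2 + h) rho (w.1, w.2 + h).
  by move=> /boxP[? ? ? ?]; apply/boxP; split => /=; lra.
exists (fun w => U (w.1, w.2 + h)), (fun w => Ux (w.1, w.2 + h)),
  (fun w => Uxx (w.1, w.2 + h)), (fun w => Ut (w.1, w.2 + h)); split.
  apply/subspace_continuousP => w sw; apply/cvgrPdist_lt => e1 e10.
  move/subspace_continuousP : cU => /(_ _ (sh w sw))/cvgrPdist_lt/(_ e1 e10).
  rewrite /within /= => /nbhs_ballP[d d0 dP].
  apply: (iffRL (@nbhs_ballP R (R * R)%type w _)); exists d => // w' [w1 w2] sw'.
  apply: dP; last exact: sh.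
  split => //=; move: w2; rewrite /ball /=.
  by rewrite (_ : w.2 + h - (w'.2 + h) = w.2 - w'.2)//; ring.
move=> w sw; have [[U1 U2 U3] Uu UR] := UP _ (sh _ sw).
split => //; split => //=.
have U3' : is_derive (w.2 + h) 1 (fun t => U (w.1, t)) (Ut (w.1, w.2 + h)) by exact: U3.
have -> : (fun t => U (w.1, t + h)) = (fun t => U (w.1, t)) \o (fun t => t + h) by [].
by apply: is_derive_eq; rewrite addr0 mulr1.
Qed.

Notation drift := (r - q - sigma ^+ 2 / 2).

(** The inequality on the two sides and the bottom excludes [u < v] there, which leaves only points
    where [P] can be used. Nothing is required where [v <= u]: with [u] built from [-y], those may
    be contact points, at which [-y] need not be a supersolution. *)
Lemma comparison_squareP (a b s0 s1 : R) u v vx vxx vt :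
  0 < r -> a <= b -> s0 <= s1 -> continuous u ->
  (forall z, C21_at v vx vxx vt z) -> continuous v ->
  (forall z, a < z.1 -> z.1 < b -> s0 < z.2 -> z.2 <= s1 ->
    residual sigma r q v vx vxx vt z <= 0) ->
  (forall z, a < z.1 -> z.1 < b -> s0 < z.2 -> z.2 <= s1 -> u z < v z ->
    supersol_at sigma r q u z) ->
  (forall s, s0 <= s -> s <= s1 -> v (a, s) <= u (a, s)) ->
  (forall s, s0 <= s -> s <= s1 -> v (b, s) <= u (b, s)) ->
  (forall x, a <= x -> x <= b -> v (x, s0) <= u (x, s0)) ->
  forall z, a <= z.1 -> z.1 <= b -> s0 <= z.2 -> z.2 <= s1 -> v z <= u z.
Proof.
move=> r0 ab s01 cu Cv cv Pv Su va vb v0.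
apply: (@comparison_box _ sigma r q a b s0 s1 u v vx vxx vt) => //.
  by move=> z *; split; [exact: Cv|exact: Pv].
move=> [x s] /= ax xb ss0 ss1 uv.
have {}ax : a < x.
  by rewrite lt_neqAle ax andbT; apply: contraTneq uv => <-; rewrite -leNgt va.
have {}xb : x < b.
  by rewrite lt_neqAle xb andbT; apply: contraTneq uv => ->; rewrite -leNgt vb.
have {}ss0 : s0 < s.
  by rewrite lt_neqAle ss0 andbT; apply: contraTneq uv => <-; rewrite -leNgt v0// ltW.
by split => //; exact: Su.
Qed.

(* Barrier [c + alpha y + N y^2 - (s0 - s) + th] with [y = x - x0] and [N] large. *)
Lemma kink_strict u (x0 s0 c alpha kappa rho0 : R) :
  0 < sigma -> 0 < r -> 0 < rho0 -> 0 < kappa -> continuous u ->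
  (forall z, `|z.1 - x0| <= rho0 -> s0 - rho0 <= z.2 -> z.2 <= s0 ->
    supersol_at sigma r q u z /\
    c + alpha * (z.1 - x0) + kappa * `|z.1 - x0| <= u z) ->
  c < u (x0, s0).
Proof.
move=> sigma0 r0 rho00 kappa0 cu H.
(* Bounds every term of [P v] other than [- sigma^2 N]: the time derivative [1], the drift term and
   [r v]. The choice [sigma^2 N = M] then gives [P v <= 0]. *)
pose M := 1 + `|drift| * (`|alpha| + kappa) + r * (`|c| + `|alpha| + kappa).
have M0 : 0 < M.
  by rewrite /M -addrA ltr_pwDl ?ltr01// addr_ge0 ?mulr_ge0 ?addr_ge0 ?(ltW r0) ?(ltW kappa0).
have [N N0 NE] : exists2 N, 0 < N & sigma ^+ 2 * N = M.
  exists (M / sigma ^+ 2); first by rewrite divr_gt0// exprn_gt0.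
  by field; rewrite gt_eqF.
(* On the lateral edges [N m^2] and [th] each consume half of the kink [kappa m]. On the bottom edge
   the time term [- m] absorbs [th], and half of the kink absorbs the quadratic term. *)
have [|m m0 /and4P[/ltW m1 /ltW m2 /ltW m3 _]] := ex_small (s := [:: 1; rho0; kappa / (2 * N)]).
  by rewrite /= ltr01 rho00 divr_gt0// mulr_gt0.
have {}m3 : N * m <= kappa / 2.
  by rewrite mulrC -ler_pdivlMr// (_ : kappa / 2 / N = kappa / (2 * N))//; field; rewrite gt_eqF.
have [|th th0 /and3P[/ltW th1 /ltW th2 _]] := ex_small (s := [:: kappa / 2 * m; m]).
  by rewrite /= m0 mulr_gt0// divr_gt0.
pose v z := c + alpha * (z.1 - x0) + N * (z.1 - x0) ^+ 2 - (s0 - z.2) + th.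
have xm : x0 - m <= x0 + m by clear -m0; lra.
have [xm1 xm2 sm] : [/\ x0 - m <= x0, x0 <= x0 + m & s0 - m <= s0] by clear -m0; split; lra.
have inH z : x0 - m <= z.1 -> z.1 <= x0 + m -> s0 - m <= z.2 -> z.2 <= s0 ->
    supersol_at sigma r q u z /\ c + alpha * (z.1 - x0) + kappa * `|z.1 - x0| <= u z.
  move=> z1 z2 z3 z4; apply: H => //; last by clear -z3 m2; lra.
  by clear -z1 z2 m2; apply/ler_normlP; split; lra.
have yy z : N * (z.1 - x0) ^+ 2 = (N * `|z.1 - x0|) * `|z.1 - x0|.
  by rewrite -mulrA -expr2 real_normK ?num_real.
have Nz z : x0 - m <= z.1 -> z.1 <= x0 + m -> `|z.1 - x0| <= m /\ N * `|z.1 - x0| <= kappa / 2.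
  move=> z1 z2; have zm : `|z.1 - x0| <= m.
    by clear -z1 z2; apply/ler_normlP; split; lra.
  by split => //; apply: le_trans m3; rewrite ler_pM2l.
have sideP z : x0 - m <= z.1 -> z.1 <= x0 + m -> s0 - m <= z.2 -> z.2 <= s0 ->
    `|z.1 - x0| = m \/ z.2 = s0 - m -> v z <= u z.
  move=> z1 z2 z3 z4 side; have [_] := inH z z1 z2 z3 z4; apply: le_trans.
  have [zm Nzm] := Nz z z1 z2; rewrite /v yy.
  have N2 : N * `|z.1 - x0| * `|z.1 - x0| <= kappa / 2 * `|z.1 - x0| by rewrite ler_wpM2r.
  have k2 : 0 <= kappa * `|z.1 - x0| by rewrite mulr_ge0// ltW.
  move: side => [zE|zE]; first by rewrite zE in N2 *; clear -N2 th1 z4; lra.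
  by rewrite zE; clear -N2 th2 k2; lra.
suff : v (x0, s0) <= u (x0, s0) by rewrite /v /= !subrr expr0n /=; clear -th0; lra.
apply: (@comparison_squareP (x0 - m) (x0 + m) (s0 - m) s0 u v
  (fun z => alpha + N * (2 * (z.1 - x0))) (fun z => N * 2) (fun z => 1)
  r0 xm sm cu _ _ _ _ _ _ _ (x0, s0) xm1 xm2 sm (lexx _)).
- by move=> z; split; rewrite /v /=; apply: is_derive_eq; rewrite /GRing.scale /=; ring.
- move=> z; apply: cvgD; last exact: cvg_cst.
  apply: cvgB; last by apply: cvgB; [exact: cvg_cst|exact: cvg_snd].
  have H1 : z'.1 - x0 @[z' --> z] --> z.1 - x0 by apply: cvgB; [exact: cvg_fst|exact: cvg_cst].
  apply: cvgD; first by apply: cvgD; [exact: cvg_cst|apply: cvgM => //; exact: cvg_cst].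
  by apply: cvgM; [exact: cvg_cst|rewrite expr2; apply: cvgM].
- move=> z /ltW z1 /ltW z2 z3 z4.
  have [zm Nzm] := Nz z z1 z2.
  have a1 : alpha * (z.1 - x0) <= `|alpha|.
    rewrite (le_trans (ler_norm _))// normrM ler_piMr//; exact: le_trans m1.
  have vle : v z <= `|c| + `|alpha| + kappa.
    rewrite /v yy.
    have : N * `|z.1 - x0| * `|z.1 - x0| <= kappa / 2 * 1.
      by apply: ler_pM => //; [rewrite mulr_ge0// ltW|exact: le_trans m1].
    have : kappa / 2 * m <= kappa / 2 by rewrite ler_piMr// divr_ge0// ltW.
    by have := ler_norm c; clear -a1 th1 z4; lra.
  have dr : - (drift * (alpha + N * (2 * (z.1 - x0)))) <= `|drift| * (`|alpha| + kappa).
    rewrite (le_trans (ler_norm _))// normrN normrM ler_wpM2l//.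
    rewrite (le_trans (ler_normD _ _))// lerD2l !normrM (gtr0_norm N0) (ger0_norm (ler0n R 2)).
    by clear -Nzm; lra.
  have rv : r * v z <= r * (`|c| + `|alpha| + kappa) by rewrite ler_pM2l.
  rewrite /residual /Lop.
  have : sigma ^+ 2 / 2 * (N * 2) = M by rewrite -NE; field.
  by rewrite /M; clear -rv dr; lra.
- by move=> z /ltW z1 /ltW z2 /ltW z3 z4 _; have [] := inH z z1 z2 z3 z4.
- move=> s s1 s2; apply: sideP => //=; left.
  by rewrite (_ : x0 - m - x0 = - m) ?normrN ?gtr0_norm//; clear; ring.
- move=> s s1 s2; apply: sideP => //=; left.
  by rewrite (_ : x0 + m - x0 = m) ?gtr0_norm//; clear; ring.
- by move=> x x1 x2; apply: sideP => //=; right.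
Qed.

End barriers.

Section explicit_barriers.
Context {R : realType}.
Variables (sigma r q : R).
Implicit Types (u v : R * R -> R) (z w : R * R).
Notation drift := (r - q - sigma ^+ 2 / 2).

Lemma expRB1_ge (x : R) : x <= expR x - 1.
Proof. by have := expR_ge1Dx x; lra. Qed.

(* Barrier [ep (e^(lam (l(s) - x)) - 1)] with [l] linear, [l s0 = a], [l s1 = b]. *)
Lemma linear_growth u (a b s0 s1 m : R) :
  0 < sigma -> 0 < r -> a < b -> s0 < s1 -> 0 < m -> continuous u ->
  (forall z, a <= z.1 -> z.1 <= b -> s0 <= z.2 -> z.2 <= s1 -> 0 <= u z) ->
  (forall s, s0 <= s -> s <= s1 -> m <= u (a, s)) ->
  (forall z, a < z.1 -> z.1 < b -> s0 < z.2 -> z.2 <= s1 -> supersol_at sigma r q u z) ->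
  exists2 k, 0 < k & forall x, a <= x -> x <= b -> k * (b - x) <= u (x, s1).
Proof.
move=> sigma0 r0 ab s01 m0 cu u0 um Su.
(* Speed of the front [l]. Right of the front the barrier is nonpositive, hence below [u] on the
   whole bottom edge and on the right edge, so strict positivity of [u] is needed on the left edge
   only. The front reaches [b] exactly at time [s1]. *)
pose c := (b - a) / (s1 - s0).
have s10 : 0 < s1 - s0 by rewrite subr_gt0.
have c0 : 0 < c by rewrite divr_gt0 ?subr_gt0.
have cE : c * (s1 - s0) = b - a by rewrite /c mulfVK ?gt_eqF.
pose M := `|c + drift| + r.
have M0 : 0 < M by rewrite ltr_wpDl.
have s20 : 0 < sigma ^+ 2 by rewrite exprn_gt0.
(* Large enough for the second-order term [sigma^2 lam^2 / 2] to dominate [lam (c + drift) + r];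
   [lam >= 1] serves to bound [r] by [lam r]. *)
pose lam := 1 + 2 * M / sigma ^+ 2.
have lam1 : 1 <= lam by rewrite lerDl divr_ge0 ?mulr_ge0 ?ltW.
have lam0 : 0 < lam by exact: lt_le_trans lam1.
have lamE : M <= sigma ^+ 2 / 2 * lam.
  rewrite /lam mulrDr mulr1 (_ : sigma ^+ 2 / 2 * (2 * M / sigma ^+ 2) = M); last first.
    by field; rewrite gt_eqF.
  by rewrite lerDr divr_ge0// ltW.
have lamP : lam * (c + drift) + r <= sigma ^+ 2 / 2 * lam ^+ 2.
  have h : lam * M <= lam * (sigma ^+ 2 / 2 * lam) by rewrite ler_pM2l.
  rewrite (_ : sigma ^+ 2 / 2 * lam ^+ 2 = lam * (sigma ^+ 2 / 2 * lam)); last by ring.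
  apply: le_trans h; rewrite /M [leRHS]mulrDr lerD//; first by rewrite ler_pM2l// ler_norm.
  by rewrite ler_peMl// ltW.
pose l s := a + c * (s - s0).
have l0 : l s0 = a by rewrite /l subrr mulr0 addr0.
have l1 : l s1 = b by rewrite /l cE addrC subrK.
have lb s : s <= s1 -> l s <= b.
  by move=> ss; rewrite -l1 lerD2l ler_pM2l// lerD2r.
pose ep := m / expR (lam * (b - a)).
have ep0 : 0 < ep by rewrite divr_gt0 ?expR_gt0.
have epE : ep * expR (lam * (b - a)) = m by rewrite /ep mulfVK// gt_eqF ?expR_gt0.
clearbody ep.
pose E z := expR (lam * (a + c * (z.2 - s0) - z.1)).
pose v z := ep * (E z - 1).
exists (ep * lam); first exact: mulr_gt0.
move=> x ax xb; apply: (@le_trans _ _ (v (x, s1))).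
  rewrite /v /E /= -/(l s1) l1 -mulrA ler_pM2l//; exact: expRB1_ge.
have v0 s y : l s <= y -> v (y, s) <= 0.
  move=> ly; rewrite /v pmulr_rle0// subr_le0 /E -expR0 ler_expR pmulr_rle0//.
  by rewrite subr_le0.
have s01' := ltW s01; have ab' := ltW ab.
apply: (@comparison_squareP _ sigma r q a b s0 s1 u v
  (fun z => ep * (- lam * E z)) (fun z => ep * (lam ^+ 2 * E z)) (fun z => ep * (lam * c * E z))
  r0 ab' s01' cu _ _ _ _ _ _ _ (x, s1) ax xb s01' (lexx _)).
- by move=> z; split; rewrite /v /E /=; apply: is_derive_eq; rewrite /GRing.scale /=; ring.
- move=> z; apply: cvgM; first exact: cvg_cst.
  apply: cvgB; last exact: cvg_cst.
  apply: (@continuous_comp _ _ _ (fun z : R * R => lam * (a + c * (z.2 - s0) - z.1)) expR);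
    last exact: continuous_expR.
  apply: cvgM; first exact: cvg_cst.
  apply: cvgB; last exact: cvg_fst.
  apply: cvgD; first exact: cvg_cst.
  apply: cvgM; first exact: cvg_cst.
  by apply: cvgB; [exact: cvg_snd|exact: cvg_cst].
- move=> z _ _ _ _; rewrite /residual /Lop /v.
  rewrite (_ : _ - _ = ep * (E z * (lam * (c + drift) + r - sigma ^+ 2 / 2 * lam ^+ 2) - r)); last by ring.
  rewrite pmulr_rle0// subr_le0; apply: (le_trans _ (ltW r0)).
  by rewrite pmulr_rle0 ?expR_gt0// subr_le0.
- by move=> z *; exact: Su.
- move=> s ss0 ss1; apply: (le_trans _ (um s ss0 ss1)).
  rewrite -epE /v ler_pM2l// (@le_trans _ _ (E (a, s)))//; first by rewrite gerBl.
  by rewrite /E /= ler_expR ler_pM2l// lerD2r; exact: lb.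
- move=> s ss0 ss1; apply: (@le_trans _ _ 0); first exact: v0 (lb _ _).
  by apply: u0 => /=.
- move=> y ay yb; apply: (@le_trans _ _ 0); first by apply: v0; rewrite l0.
  by apply: u0 => /=.
Qed.

(* Barrier [ep e^(- Lam (s - s0)) (rho^2 - (x - x0)^2)^2]. *)
Lemma positivity_propagates u (x0 rho s0 s1 m : R) :
  0 < sigma -> 0 < r -> 0 < rho -> s0 <= s1 -> 0 < m -> continuous u ->
  (forall z, x0 - rho <= z.1 -> z.1 <= x0 + rho -> s0 <= z.2 -> z.2 <= s1 -> 0 <= u z) ->
  (forall x, x0 - rho <= x -> x <= x0 + rho -> m <= u (x, s0)) ->
  (forall z, x0 - rho < z.1 -> z.1 < x0 + rho -> s0 < z.2 -> z.2 <= s1 ->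
    supersol_at sigma r q u z) ->
  0 < u (x0, s1).
Proof.
move=> sigma0 r0 rho0 s01 m0 cu u0 um Su.
have s20 : 0 < sigma ^+ 2 by rewrite exprn_gt0.
pose D := `|drift| * rho.
have D0 : 0 <= D by rewrite mulr_ge0// ltW.
pose P (y : R) := rho ^+ 2 - y ^+ 2.
(* With [t = rho^2 - y^2], this [A] makes [A t^2 - (6 sigma^2 + 4 D) t + 4 sigma^2 rho^2] a multiple
   of a perfect square. Up to a positive factor, [P v] is at most minus this quadratic. *)
pose A := (6 * sigma ^+ 2 + 4 * D) ^+ 2 / (16 * sigma ^+ 2 * rho ^+ 2).
have C0 : 0 < 4 * sigma ^+ 2 * rho ^+ 2 by rewrite !mulr_gt0// exprn_gt0.
have quad t : (6 * sigma ^+ 2 + 4 * D) * t <= A * t ^+ 2 + 4 * sigma ^+ 2 * rho ^+ 2.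
  rewrite -subr_ge0 (_ : _ - _ = ((6 * sigma ^+ 2 + 4 * D) * t - 8 * sigma ^+ 2 * rho ^+ 2) ^+ 2 /
     (16 * sigma ^+ 2 * rho ^+ 2)); last first.
    by rewrite /A; field; rewrite !gt_eqF.
  by rewrite divr_ge0 ?sqr_ge0// mulr_ge0 ?sqr_ge0// mulr_ge0 ?sqr_ge0.
pose Lam := A + r.
pose ep := m / rho ^+ 4.
have r40 : 0 < rho ^+ 4 by rewrite exprn_gt0.
have ep0 : 0 < ep by rewrite divr_gt0.
have epE : ep * rho ^+ 4 = m by rewrite /ep mulfVK// gt_eqF.
clearbody ep.
pose E z := expR (- Lam * (z.2 - s0)).
pose v z := ep * E z * (P (z.1 - x0)) ^+ 2.
have Ppos x : x0 - rho <= x -> x <= x0 + rho -> 0 <= P (x - x0) <= rho ^+ 2.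
  move=> x1 x2; rewrite /P subr_ge0 gerBl sqr_ge0 andbT.
  have xr : `|x - x0| <= rho by clear -x1 x2; apply/ler_normlP; split; lra.
  by rewrite -(real_normK (num_real (x - x0))) lerXn2r// nnegrE ltW.
suff : v (x0, s1) <= u (x0, s1).
  apply: lt_le_trans; rewrite /v /P /= subrr expr0n /= subr0.
  by rewrite !mulr_gt0// ?expR_gt0// exprn_gt0// exprn_gt0.
have [xm1 xm2] : x0 - rho <= x0 /\ x0 <= x0 + rho by clear -rho0; split; lra.
have xm := le_trans xm1 xm2.
apply: (@comparison_squareP _ sigma r q (x0 - rho) (x0 + rho) s0 s1 u v
  (fun z => ep * E z * (- 4 * (z.1 - x0) * P (z.1 - x0)))
  (fun z => ep * E z * (8 * (z.1 - x0) ^+ 2 - 4 * P (z.1 - x0)))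
  (fun z => - Lam * v z)
  r0 xm s01 cu _ _ _ _ _ _ _ (x0, s1) xm1 xm2 s01 (lexx _)).
- by move=> z; split; rewrite /v /E /P /=; apply: is_derive_eq; rewrite /GRing.scale /=; ring.
- have cP : continuous (fun z : R * R => P (z.1 - x0)).
    move=> z; apply: cvgB; first exact: cvg_cst.
    have H1 : z'.1 - x0 @[z' --> z] --> z.1 - x0 by apply: cvgB; [exact: cvg_fst|exact: cvg_cst].
    by rewrite expr2; apply: cvgM.
  move=> z; apply: cvgM; last by rewrite expr2; apply: cvgM; exact: cP.
  apply: cvgM; first exact: cvg_cst.
  apply: (@continuous_comp _ _ _ (fun z : R * R => - Lam * (z.2 - s0)) expR);
    last exact: continuous_expR.
  apply: cvgM; first exact: cvg_cst.
  by apply: cvgB; [exact: cvg_snd|exact: cvg_cst].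
- move=> z /ltW z1 /ltW z2 _ _; rewrite /residual /Lop /v.
  have /andP[t0 _] := Ppos z.1 z1 z2.
  set y := z.1 - x0 in t0 *.
  have y2 : y ^+ 2 = rho ^+ 2 - P y by rewrite /P opprB addrC subrK.
  rewrite (_ : _ - _ = ep * E z * (- A * P y ^+ 2 - sigma ^+ 2 / 2 * (8 * y ^+ 2 - 4 * P y)
      + 4 * (drift * y) * P y)); last by rewrite /Lam; ring.
  rewrite pmulr_rle0; last by rewrite mulr_gt0 ?expR_gt0.
  have dy : drift * y * P y <= D * P y.
    rewrite ler_wpM2r// (le_trans (ler_norm _))// normrM ler_wpM2l//.
    by rewrite /y; clear -z1 z2; apply/ler_normlP; split; lra.
  by rewrite y2; have := quad (P y); clear -dy; lra.
- by move=> z *; exact: Su.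
- move=> s ss0 ss1; rewrite /v /P /= (_ : x0 - rho - x0 = - rho); last by ring.
  by rewrite sqrrN subrr expr0n /= mulr0; apply: u0 => //=.
- move=> s ss0 ss1; rewrite /v /P /= (_ : x0 + rho - x0 = rho); last by ring.
  by rewrite subrr expr0n /= mulr0; apply: u0 => //=.
- move=> x x1 x2; apply: (le_trans _ (um x x1 x2)).
  rewrite /v /E /= subrr mulr0 expR0 mulr1 -epE ler_pM2l// (_ : rho ^+ 4 = (rho ^+ 2) ^+ 2); last by ring.
  by have /andP[? ?] := Ppos x x1 x2; rewrite lerXn2r// nnegrE// sqr_ge0.
Qed.

End explicit_barriers.

Section admissible.
Context {R : realType}.
Variables (K1 k1 K2 sigma r q T : R).

Record admissible : Prop := {
  K1_gt0 : 0 < K1; K1_lt_k1 : K1 < k1; k1_lt_K2 : k1 < K2;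
  sigma_gt0 : 0 < sigma; r_gt0 : 0 < r; q_ge0 : 0 <= q; T_gt0 : 0 < T }.

End admissible.

(** * Monotonicity in time *)

Section monotonicity.
Context {R : realType}.
Variables (K1 k1 K2 sigma r q T : R).
Implicit Types (y : R * R -> R) (x s t h : R).
Notation psi := (psi1 K1 k1 K2).
Notation obstacle_solution := (obstacle_solution K1 k1 K2 sigma r q T).
Notation drift := (r - q - sigma ^+ 2 / 2).

Notation admissible := (admissible K1 k1 K2 sigma r q T).

Local Ltac isolate := clear -K1 k1 K2 sigma r q T.

(* The barrier [- e e^(beta s - x)] controls [x -> -oo], where [y] is only bounded. *)
Lemma obstacle_solution_shift_ge y x s h : admissible -> obstacle_solution y ->
  x <= ln k1 -> 0 <= s -> 0 < h -> s + h < T -> y (x, s) <= y (x, s + h).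
Proof.
move=> ok oy xk s0 h0 shT.
have [M Mb] := os_bounded oy.
have M0 : 0 <= M by apply: le_trans (Mb (0, 0)).
(* For [E = exp(beta s - x)] this gives [P E = (|drift| + drift + r) E >= 0], so [- e E] is a
   subsolution whatever the sign of the drift. *)
pose beta := sigma ^+ 2 / 2 + `|drift|.
have beta0 : 0 <= beta by rewrite addr_ge0// divr_ge0// sqr_ge0.
rewrite -subr_ge0; apply/ler_addgt0Pr => e' e'0; rewrite -lerBlDr sub0r.
have Ex0 : 0 < expR (- x + beta * s) := expR_gt0 _.
pose e := e' / expR (- x + beta * s).
have e0 : 0 < e by rewrite divr_gt0.
have eE : e * expR (- x + beta * s) = e' by rewrite /e mulfVK// gt_eqF.
(* At [x = a <= - N] one has [e E >= e N = 2 M], which puts the barrier below any difference of two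
   values of [y]. *)
pose N := 2 * M / e.
have N0 : 0 <= N by rewrite /N divr_ge0 ?mulr_ge0// ltW.
have NE : e * N = 2 * M by rewrite /N mulrC mulfVK// gt_eqF.
clearbody e N.
pose a := Num.min x (- N).
have ax : a <= x by rewrite /a ge_min lexx.
have aN : a <= - N by rewrite /a ge_min lexx orbT.
clearbody a.
pose u (z : R * R) := y (z.1, z.2 + h) + - y z.
pose E (z : R * R) := expR (- z.1 + beta * z.2).
pose v (z : R * R) := - e * E z.
have cy := os_continuous oy.
have cys : continuous (fun z : R * R => y (z.1, z.2 + h)) by exact: continuous_shift.
have cu : continuous u by move=> z; apply: cvgD; [exact: cys|apply: cvgN; exact: cy].
have v0 z : v z <= 0 by rewrite /v mulNr oppr_le0 mulr_ge0 ?expR_ge0 ?ltW.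
rewrite -eE -mulNr; apply: (le_trans (y := v (x, s))) => //.
have tT t : t <= s -> t + h < T by move=> ts; apply: le_lt_trans shT; rewrite lerD2r.
have tT' t : t <= s -> t < T by move=> /tT; apply: lt_trans; rewrite ltrDl.
have th0 t : 0 <= t -> 0 <= t + h by move=> t0; rewrite addr_ge0// ltW.
apply: (@comparison_squareP _ sigma r q a (ln k1) 0 s u v
  (fun z => e * E z) (fun z => - e * E z) (fun z => - e * (beta * E z))
  (r_gt0 ok) (le_trans ax xk) s0 cu _ _ _ _ _ _ _ (x, s) ax xk s0 (lexx _)).
- by move=> z; split; rewrite /v /E /=; apply: is_derive_eq; rewrite /GRing.scale /=; ring.
- move=> z; apply: cvgM; first exact: cvg_cst.
  apply: (@continuous_comp _ _ _ (fun z : R * R => - z.1 + beta * z.2) expR);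
    last exact: continuous_expR.
  apply: cvgD; first by apply: cvgN; exact: cvg_fst.
  by apply: cvgM; [exact: cvg_cst|exact: cvg_snd].
- move=> z _ _ _ _; rewrite /residual /Lop /v.
  rewrite (_ : _ - _ = - (e * E z * (`|drift| + drift + r))); last by rewrite /beta; field.
  rewrite oppr_le0 mulr_ge0//; first by rewrite mulr_ge0 ?expR_ge0 ?ltW.
  by rewrite addr_ge0 ?(ltW (r_gt0 ok))// -lerBlDr sub0r -normrN ler_norm.
- move=> z za zk z0 zs uv.
  have zT := tT' _ zs.
  apply: (supersol_atD (u := fun z => y (z.1, z.2 + h)) (v := \- y)).
    apply: supersol_at_shift; apply: (os_super oy) => //=; last exact: tT.
    by rewrite addr_gt0.
  (* Here [u < v <= 0], so [y] exceeds its translate and hence the obstacle: the point is off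
     contact. *)
  apply: (os_sub oy) => //.
  have := lt_le_trans uv (v0 z); rewrite /u subr_lt0; apply: le_lt_trans.
  by apply: (os_ge oy (z := (z.1, z.2 + h))) => /=; [exact: ltW|apply: th0; exact: ltW|apply: ltW; exact: tT].
- move=> t t0 ts; rewrite /v /E /u /=.
  have E1 : N <= expR (- a + beta * t).
    apply: (@le_trans _ _ (expR N)); first by have := expR_ge1Dx N; isolate; lra.
    by rewrite ler_expR -[leLHS]addr0 lerD ?mulr_ge0// lerNr.
  have : e * N <= e * expR (- a + beta * t) by rewrite ler_pM2l.
  rewrite NE; have := Mb (a, t + h); have := Mb (a, t).
  by isolate; move=> /ler_normlP[? ?] /ler_normlP[? ?] ?; lra.
- move=> t t0 ts; apply: (le_trans (v0 _)); rewrite /u /=.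
  rewrite (os_lateral oy) ?th0 ?(ltW (tT _ ts))//.
  by rewrite (os_lateral oy) ?subrr// (ltW (tT' _ ts)).
- move=> x' ax' x'k; apply: (le_trans (v0 _)); rewrite /u /= subr_ge0 (os_init oy)// add0r.
  apply: (os_ge oy (z := (x', h))) => //=; first exact: ltW.
  by rewrite ltW// (le_lt_trans _ shT)// lerDr.
Qed.

Lemma obstacle_solution_nondecreasing y x s t : admissible -> obstacle_solution y ->
  x <= ln k1 -> 0 <= s -> s <= t -> t <= T -> y (x, s) <= y (x, t).
Proof.
move=> ok oy xk s0; rewrite le_eqVlt => /predU1P[->//|st].
rewrite le_eqVlt => /predU1P[tT|tT]; last first.
  have -> : t = s + (t - s) by rewrite addrC subrK.
  by apply: obstacle_solution_shift_ge => //; rewrite ?subr_gt0// addrC subrK.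
rewrite leNgt; apply/negP => yts.
have [d d0 dP] := continuous_square (x, t) (os_continuous oy)
  (e := y (x, s) - y (x, t)) ltac:(by rewrite subr_gt0).
have [|h h0 /and3P[hd hst _]] := ex_small (s := [:: d; t - s]).
  by rewrite /= d0 subr_gt0 st.
have st' : s < t - h by move: hst; isolate; lra.
have := dP (x, t - h); rewrite /= subrr normr0 => /(_ d0).
rewrite addrAC subrr add0r normrN gtr0_norm// => /(_ hd) /ltr_normlP[_].
have : y (x, s) <= y (x, t - h).
  have -> : t - h = s + (t - h - s) by ring.
  apply: obstacle_solution_shift_ge => //; first by rewrite subr_gt0.
  by rewrite addrC subrK -tT ltrBlDr ltrDl.
by isolate; lra.
Qed.

Lemma contact_backward y x s t : admissible -> obstacle_solution y ->
  x <= ln k1 -> 0 <= s -> s <= t -> t <= T -> y (x, t) = psi x -> y (x, s) = psi x.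
Proof.
move=> ok oy xk s0 st tT yt; apply/eqP; rewrite eq_le.
rewrite -{1}yt (obstacle_solution_nondecreasing ok oy)//=.
by apply: (os_ge oy (z := (x, s))) => //=; exact: le_trans tT.
Qed.

End monotonicity.

(** * The contact set *)

Section contact.
Context {R : realType}.
Variables (K1 k1 K2 sigma r q T : R).
Implicit Types (y : R * R -> R) (x s t h : R).
Notation psi := (psi1 K1 k1 K2).
Notation obstacle_solution := (obstacle_solution K1 k1 K2 sigma r q T).
Notation admissible := (admissible K1 k1 K2 sigma r q T).
Notation drift := (r - q - sigma ^+ 2 / 2).
Local Ltac isolate := clear -K1 k1 K2 sigma r q T.

Definition payoff x : R := expR x - K1 + K2 - k1.
(* [cost x] is [P payoff] at [x]. *)
Definition cost x : R := q * expR x - r * (K1 + k1 - K2).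

Lemma psi1_payoff x : 0 < K1 -> ln K1 <= x -> psi x = payoff x.
Proof.
move=> K10 Kx; rewrite /psi1 /payoff max_l//.
by rewrite subr_ge0 -[leLHS](lnK (x := K1)) ?posrE// ler_expR.
Qed.

Lemma payoff_le_psi1 x : payoff x <= psi x.
Proof. by rewrite /payoff /psi1 lerB// lerD// le_max lexx. Qed.

Lemma const_le_psi1 x : K2 - k1 <= psi x.
Proof. by rewrite /psi1 lerB// -[leLHS]add0r lerD// le_max lexx orbT. Qed.

Lemma payoff_continuous : continuous payoff.
Proof.
move=> x; apply: cvgB; last exact: cvg_cst.
apply: cvgD; last exact: cvg_cst.
by apply: cvgB; [exact: continuous_expR|exact: cvg_cst].
Qed.

Lemma cost_continuous : continuous cost.
Proof.
move=> x; apply: cvgB; last exact: cvg_cst.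
by apply: cvgM; [exact: cvg_cst|exact: continuous_expR].
Qed.

Lemma cost_le x x' : 0 <= q -> x <= x' -> cost x <= cost x'.
Proof. by move=> q0 xx; rewrite lerD2r ler_wpM2l// ler_expR. Qed.

Lemma lnK1_lt_lnk1 : admissible -> ln K1 < ln k1.
Proof.
move=> ok; have K10 := K1_gt0 ok; have Kk := K1_lt_k1 ok.
by rewrite ltr_ln ?posrE// (lt_trans K10).
Qed.

(** Right of [x1] the cost is nonnegative, so [- payoff] is a subsolution, to be compared with
    [- y]. They agree on the bottom, at [ln k1], and at [x1] because contact there extends to all
    earlier times. The comparison gives [y <= payoff]. *)
Lemma contact_interval y x1 t x s : admissible -> obstacle_solution y ->
  ln K1 <= x1 -> 0 <= cost x1 -> t < T -> y (x1, t) = psi x1 ->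
  x1 <= x -> x <= ln k1 -> 0 <= s -> s <= t -> y (x, s) = psi x.
Proof.
move=> ok oy Kx1 cx1 tT yx1 x1x xk s0 st.
have K10 := K1_gt0 ok.
have t0 : 0 <= t by exact: le_trans st.
have tT' := ltW tT.
have x1k := le_trans x1x xk.
have Kx := le_trans Kx1 x1x.
apply/eqP; rewrite eq_le; apply/andP; split; last first.
  by apply: (os_ge oy (z := (x, s))) => //=; exact: le_trans tT'.
rewrite psi1_payoff// -lerN2.
pose v (z : R * R) := - payoff z.1.
have cy := os_continuous oy.
suff : v (x, s) <= (\- y) (x, s) by [].
apply: (@comparison_squareP _ sigma r q x1 (ln k1) 0 t (\- y) v
  (fun z => - expR z.1) (fun z => - expR z.1) (fun z => 0)
  (r_gt0 ok) x1k t0 _ _ _ _ _ _ _ _ (x, s) x1x xk s0 st).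
- by move=> z; apply: cvgN; exact: cy.
- move=> z; split; rewrite /v /payoff /=; apply: is_derive_eq;
    by rewrite /GRing.scale /=; ring.
- move=> z; apply: cvgN.
  by apply: (@continuous_comp _ _ _ fst payoff); [exact: cvg_fst|exact: payoff_continuous].
- move=> z z1 _ _ _; rewrite /residual /Lop.
  rewrite (_ : _ - _ = - cost z.1); last by rewrite /cost /v /payoff; field.
  by rewrite oppr_le0 (le_trans cx1)// cost_le ?(q_ge0 ok)// ltW.
- move=> z z1 z2 z3 z4; rewrite /v ltrN2 => vy.
  apply: (os_sub oy) => //; first exact: le_lt_trans tT.
  by rewrite psi1_payoff// (le_trans Kx1)// ltW.
- move=> t' t'0 t't; rewrite lerN2 (contact_backward ok oy x1k t'0 t't tT' yx1).
  by rewrite psi1_payoff.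
- move=> t' t'0 t't; rewrite lerN2 (os_lateral oy)//; last exact: le_trans tT'.
  by rewrite -psi1_payoff ?psi1_lnk1 ?(K1_lt_k1 ok)// ltW ?lnK1_lt_lnk1.
- move=> x' x'1 x'2; rewrite lerN2 (os_init oy)// psi1_payoff//.
  exact: le_trans x'1.
Qed.

(** Near [x0] the cost is at most [- l]. This leaves room to raise [payoff] by [th] and subtract a
    small paraboloid, spending [l / 2] on each, while remaining a subsolution. The paraboloid is at
    least [th] on the sides and the bottom, so the barrier is below [y] there, yet it exceeds
    [payoff] at [(x0, s0)]. *)
Lemma noncontact_interior y x0 s0 : admissible -> obstacle_solution y ->
  ln K1 < x0 -> x0 < ln k1 -> 0 < s0 -> s0 < T -> cost x0 < 0 -> payoff x0 < y (x0, s0).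
Proof.
move=> ok oy Kx0 x0k s00 s0T cx0.
have r0 := r_gt0 ok; have cy := os_continuous oy.
pose l := - cost x0 / 2.
have l0 : 0 < l by rewrite divr_gt0// oppr_gt0.
have cc : continuous (fun z : R * R => cost z.1).
  by move=> z; apply: (@continuous_comp _ _ _ fst cost); [exact: cvg_fst|exact: cost_continuous].
have [d d0 dP] := continuous_square (x0, s0) cc l0.
have dcost (z : R * R) : `|z.1 - x0| < d -> cost z.1 <= - l.
  move=> zd; have := dP (z.1, s0) zd; rewrite /= subrr normr0 => /(_ d0).
  by move=> /ltr_normlP[_]; rewrite /l; isolate; lra.
have [|rho rho0 /and5P[/ltW r1 rd rK rk /andP[rs _]]] :=
    ex_small (s := [:: 1; d; x0 - ln K1; ln k1 - x0; s0]).
  by rewrite /= ltr01 d0 !subr_gt0 Kx0 x0k s00.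
pose M := 1 + sigma ^+ 2 + 2 * `|drift|.
have M0 : 0 < M by rewrite /M -addrA ltr_pwDl ?addr_ge0 ?sqr_ge0 ?mulr_ge0.
have [|A A0 /andP[/ltW AM _]] := ex_small (s := [:: l / (2 * M)]).
  by rewrite /= andbT divr_gt0// mulr_gt0.
have {}AM : A * M <= l / 2.
  by rewrite -ler_pdivlMr// (_ : l / 2 / M = l / (2 * M))//; field; rewrite gt_eqF.
have rho20 : 0 < rho ^+ 2 by rewrite exprn_gt0.
have [|th th0 /and3P[/ltW th1 /ltW th2 _]] := ex_small (s := [:: l / (2 * r); A * rho ^+ 2]).
  by rewrite /= andbT; apply/andP; split; [rewrite divr_gt0// mulr_gt0|rewrite mulr_gt0].
have {}th1 : r * th <= l / 2.
  by rewrite mulrC -ler_pdivlMr// (_ : l / 2 / r = l / (2 * r))//; field; rewrite gt_eqF.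
clearbody l.
pose v (z : R * R) := payoff z.1 + th - A * ((z.1 - x0) ^+ 2 + (s0 - z.2)).
have [xm1 xm2] : x0 - rho <= x0 /\ x0 <= x0 + rho by move: rho0; isolate; split; lra.
have xm := le_trans xm1 xm2.
have sm : s0 - rho <= s0 by move: rho0; isolate; lra.
have inQ z : x0 - rho <= z.1 -> z.1 <= x0 + rho -> s0 - rho <= z.2 -> z.2 <= s0 ->
   [/\ z.1 < ln k1, 0 < z.2 & z.2 < T] /\ payoff z.1 <= y z.
  move=> z1 z2 z3 z4.
  have [h1 h2] : z.1 < ln k1 /\ 0 < z.2 by move: z1 z2 z3 rk rs; isolate; split; lra.
  have h3 := le_lt_trans z4 s0T; split => //.
  by apply: le_trans (payoff_le_psi1 _) _; apply: (os_ge oy); exact: ltW.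
have rho2 : rho ^+ 2 <= rho by rewrite expr2 ler_piMr// ltW.
have sideP z : x0 - rho <= z.1 -> z.1 <= x0 + rho -> s0 - rho <= z.2 -> z.2 <= s0 ->
   rho ^+ 2 <= (z.1 - x0) ^+ 2 + (s0 - z.2) -> v z <= y z.
  move=> z1 z2 z3 z4 gz; have [_] := inQ z z1 z2 z3 z4; apply: le_trans.
  have : A * rho ^+ 2 <= A * ((z.1 - x0) ^+ 2 + (s0 - z.2)) by rewrite ler_pM2l.
  by rewrite /v; move: th2; isolate; lra.
suff : v (x0, s0) <= y (x0, s0).
  by apply: lt_le_trans; rewrite /v /= !subrr expr0n /= addr0 mulr0 subr0 ltrDl.
apply: (@comparison_squareP _ sigma r q (x0 - rho) (x0 + rho) (s0 - rho) s0 y v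
  (fun z => expR z.1 - A * (2 * (z.1 - x0))) (fun z => expR z.1 - A * 2) (fun z => A)
  r0 xm sm cy _ _ _ _ _ _ _ (x0, s0) xm1 xm2 sm (lexx _)).
- by move=> z; split; rewrite /v /payoff /=; apply: is_derive_eq; rewrite /GRing.scale /=; ring.
- move=> z; apply: cvgB.
    apply: cvgD; last exact: cvg_cst.
    by apply: (@continuous_comp _ _ _ fst payoff); [exact: cvg_fst|exact: payoff_continuous].
  have H1 : z'.1 - x0 @[z' --> z] --> z.1 - x0 by apply: cvgB; [exact: cvg_fst|exact: cvg_cst].
  apply: cvgM; first exact: cvg_cst.
  apply: cvgD; first by rewrite expr2; apply: cvgM.
  by apply: cvgB; [exact: cvg_cst|exact: cvg_snd].
- move=> z z1 z2 z3 z4.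
  have zr : `|z.1 - x0| <= rho by move: (ltW z1) (ltW z2); isolate; move=> *; apply/ler_normlP; split; lra.
  have c1 := dcost z (le_lt_trans zr rd).
  have g0 : 0 <= A * (r * ((z.1 - x0) ^+ 2 + (s0 - z.2))).
    by apply: mulr_ge0; [exact: ltW|rewrite mulr_ge0 ?(ltW r0)// addr_ge0 ?sqr_ge0// subr_ge0].
  have dz : A * (drift * (z.1 - x0)) <= A * `|drift|.
    rewrite ler_pM2l// (le_trans (ler_norm _))// normrM ler_piMr//.
    exact: le_trans r1.
  rewrite /residual /Lop.
  rewrite (_ : _ - _ = cost z.1 + r * th + A * (1 + sigma ^+ 2) + 2 * (A * (drift * (z.1 - x0)))
     - A * (r * ((z.1 - x0) ^+ 2 + (s0 - z.2)))); last by rewrite /cost /v /payoff; field.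
  by move: AM; rewrite /M; move: c1 g0 dz th1; isolate; lra.
- move=> z /ltW z1 /ltW z2 /ltW z3 z4 _; have [[h1 h2 h3] _] := inQ z z1 z2 z3 z4.
  exact: (os_super oy).
- move=> s s1 s2; apply: sideP => //=.
  by rewrite (_ : x0 - rho - x0 = - rho) ?sqrrN ?lerDl ?subr_ge0//; ring.
- move=> s s1 s2; apply: sideP => //=.
  by rewrite (_ : x0 + rho - x0 = rho) ?lerDl ?subr_ge0//; ring.
- move=> x x1 x2; apply: sideP => //=.
  rewrite (_ : s0 - (s0 - rho) = rho); last by ring.
  by apply: (le_trans rho2); rewrite lerDr sqr_ge0.
Qed.

(** Contact would already hold at half the time, which is below [T] even when [s0 = T]. *)
Lemma noncontact_below y x0 s0 : admissible -> obstacle_solution y ->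
  ln K1 < x0 -> x0 < ln k1 -> 0 < s0 -> s0 <= T -> cost x0 < 0 -> psi x0 < y (x0, s0).
Proof.
move=> ok oy Kx0 x0k s00 s0T cx0.
rewrite lt_neqAle (os_ge oy (z := (x0, s0)) (ltW x0k) (ltW s00) s0T) andbT.
apply/eqP => /esym ys.
have [h0 hs] : 0 <= s0 / 2 /\ s0 / 2 < s0 by move: s00; isolate; split; lra.
have yh := contact_backward ok oy (ltW x0k) h0 (ltW hs) s0T ys.
have := noncontact_interior ok oy Kx0 x0k (s0 := s0 / 2) ltac:(by rewrite divr_gt0) (lt_le_trans hs s0T) cx0.
by rewrite yh psi1_payoff ?ltxx// ?(K1_gt0 ok)// ltW.
Qed.

Lemma noncontact_lnK1 y s0 : admissible -> obstacle_solution y ->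
  0 < s0 -> s0 <= T -> psi (ln K1) < y (ln K1, s0).
Proof.
move=> ok oy s00 s0T; have K10 := K1_gt0 ok; have Kk := lnK1_lt_lnk1 ok.
have psiK : psi (ln K1) = K2 - k1.
  by rewrite psi1_payoff// /payoff lnK ?posrE//; ring.
rewrite lt_neqAle (os_ge oy (z := (ln K1, s0)) (ltW Kk) (ltW s00) s0T) andbT.
apply/eqP => /esym ys.
have [h0 hs] : 0 < s0 / 2 /\ s0 / 2 < s0 by move: s00; isolate; split; lra.
have := contact_backward ok oy (ltW Kk) (ltW h0) (ltW hs) s0T ys.
suff : psi (ln K1) < y (ln K1, s0 / 2) by move=> /[swap] ->; rewrite ltxx.
have [|rho rho0 /and3P[rk rs _]] := ex_small (s := [:: ln k1 - ln K1; s0 / 2]).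
  by rewrite /= subr_gt0 Kk h0.
(* The obstacle is constant left of [ln K1] and has slope at least [K1] to the right. It thus
   dominates [K2 - k1 + K1 max(x - ln K1, 0)], which is the kink with [alpha = kappa = K1 / 2]. *)
rewrite psiK; apply: (@kink_strict _ sigma r q y (ln K1) (s0 / 2) (K2 - k1) (K1 / 2) (K1 / 2) rho
  (sigma_gt0 ok) (r_gt0 ok) rho0 _ (os_continuous oy)); first by rewrite divr_gt0.
move=> z zr z1 z2; move: (zr) => /ler_normlP[zr1 zr2].
have [h1 h2] : z.1 < ln k1 /\ 0 < z.2 by move: zr2 z1 rk rs; isolate; split; lra.
have h3 : z.2 < T by apply: le_lt_trans z2 _; exact: lt_le_trans hs s0T.
split; first exact: (os_super oy).
apply: (le_trans _ (os_ge oy (ltW h1) (ltW h2) (ltW h3))).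
have [zK|Kz] := leP z.1 (ln K1).
  rewrite ler0_norm ?subr_le0//; apply: (le_trans _ (const_le_psi1 _)).
  by isolate; lra.
rewrite gtr0_norm ?subr_gt0//; apply: (le_trans _ (payoff_le_psi1 _)).
rewrite /payoff; have -> : expR z.1 = K1 * expR (z.1 - ln K1).
  by rewrite expRB lnK ?posrE// mulrCA mulfV ?mulr1// gt_eqF.
have : K1 * (z.1 - ln K1) <= K1 * (expR (z.1 - ln K1) - 1) by rewrite ler_pM2l// expRB1_ge.
by isolate; lra.
Qed.

(** Off contact [P y = 0], whereas [P payoff] is at least [cost a > 0]. Started from [payoff], [y]
    is therefore pushed down: comparison of [- y] with [v] gives [y <= payoff - D h] above the
    midpoint [m], which violates the obstacle condition. *)
Lemma contact_persists y a b t0 t1 : admissible -> obstacle_solution y ->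
  ln K1 <= a -> a < b -> b <= ln k1 -> 0 < cost a -> 0 <= t0 -> t0 < t1 -> t1 < T ->
  (forall x, a <= x -> x <= b -> y (x, t0) = psi x) ->
  (forall x s, a < x -> x < b -> t0 < s -> s <= t1 -> psi x < y (x, s)) -> False.
Proof.
move=> ok oy Ka ab bk ca t00 t01 t1T yt0 ync.
have r0 := r_gt0 ok; have K10 := K1_gt0 ok; have cy := os_continuous oy.
pose m := (a + b) / 2; pose w := (b - a) / 2.
have w0 : 0 < w by rewrite divr_gt0// subr_gt0.
have aE : a = m - w by rewrite /m /w; isolate; lra.
have bE : b = m + w by rewrite /m /w; isolate; lra.
pose M := sigma ^+ 2 + 2 * `|drift| * w.
have M0 : 0 <= M by apply: addr_ge0; [exact: sqr_ge0|apply: mulr_ge0; [exact: mulr_ge0|exact: ltW]].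
(* The surplus [cost a] is split evenly: half pays for the parabola of height [A], half for the
   growth rate [D], including the term [r D (s - t0)]. *)
have [|A A0 /andP[/ltW AM _]] := ex_small (s := [:: cost a / (2 * (M + 1))]).
  by rewrite /= andbT divr_gt0// mulr_gt0// ltr_wpDl.
have {}AM : A * (M + 1) <= cost a / 2.
  rewrite -ler_pdivlMr ?ltr_wpDl// (_ : cost a / 2 / (M + 1) = cost a / (2 * (M + 1)))//.
  by field; rewrite gt_eqF// ltr_wpDl.
have T0 := T_gt0 ok.
have rT : 0 < 1 + r * T by rewrite ltr_pwDl// mulr_ge0 ?ltW.
have [|D D0 /andP[/ltW DM _]] := ex_small (s := [:: cost a / (2 * (1 + r * T))]).
  by rewrite /= andbT divr_gt0// mulr_gt0.
have {}DM : D * (1 + r * T) <= cost a / 2.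
  rewrite -ler_pdivlMr// (_ : cost a / 2 / (1 + r * T) = cost a / (2 * (1 + r * T)))//.
  by field; rewrite gt_eqF.
have A1 : 0 < A * w ^+ 2 by rewrite mulr_gt0// exprn_gt0.
have A2 : 0 < A * w ^+ 2 / 2 by rewrite divr_gt0.
have [da da0 daP] := continuous_square (a, t0) cy A2.
have [db db0 dbP] := continuous_square (b, t0) cy A2.
(* On the sides the parabola leaves a margin [A w^2]. Up to time [t0 + h], half of it covers the
   variation of [y] and the other half covers [D h]. *)
have [|h h0 /and5P[hda hdb ht /ltW hD _]] := ex_small (s := [:: da; db; t1 - t0; A * w ^+ 2 / 2 / D]).
  by rewrite /= da0 db0 subr_gt0 t01 !divr_gt0.
have {}hD : D * h <= A * w ^+ 2 / 2 by rewrite mulrC -ler_pdivlMr.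
have th : t0 <= t0 + h by rewrite lerDl ltW.
have tht1 : t0 + h <= t1 by move: ht; isolate; lra.
have Kb : ln K1 <= b by exact: le_trans Ka (ltW ab).
have [am mb] : a <= m /\ m <= b by rewrite aE bE; move: w0; isolate; split; lra.
pose v (z : R * R) := - payoff z.1 - A * (z.1 - m) ^+ 2 + D * (z.2 - t0).
have main : v (m, t0 + h) <= (\- y) (m, t0 + h).
  apply: (@comparison_squareP _ sigma r q a b t0 (t0 + h) (\- y) v
    (fun z => - expR z.1 - A * (2 * (z.1 - m))) (fun z => - expR z.1 - A * 2) (fun z => D)
    r0 (ltW ab) th _ _ _ _ _ _ _ _ (m, t0 + h) am mb th (lexx _)).
  - by move=> z; apply: cvgN; exact: cy.
  - by move=> z; split; rewrite /v /payoff /=; apply: is_derive_eq; rewrite /GRing.scale /=; ring.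
  - move=> z; apply: cvgD.
      apply: cvgB.
        apply: cvgN.
        by apply: (@continuous_comp _ _ _ fst payoff); [exact: cvg_fst|exact: payoff_continuous].
      have H1 : z'.1 - m @[z' --> z] --> z.1 - m by apply: cvgB; [exact: cvg_fst|exact: cvg_cst].
      by apply: cvgM; [exact: cvg_cst|rewrite expr2; apply: cvgM].
    apply: cvgM; first exact: cvg_cst.
    by apply: cvgB; [exact: cvg_snd|exact: cvg_cst].
  - move=> z z1 z2 z3 z4.
    have zw : `|z.1 - m| <= w.
      by move: (ltW z1) (ltW z2); rewrite aE bE; isolate; move=> *; apply/ler_normlP; split; lra.
    have dz : - (A * (drift * (z.1 - m))) * - 1 <= A * (`|drift| * w).
      rewrite mulrN1 opprK ler_pM2l// (le_trans (ler_norm _))// normrM ler_wpM2l//.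
    have g0 : 0 <= r * (A * (z.1 - m) ^+ 2).
      by rewrite mulr_ge0 ?(ltW r0)// mulr_ge0 ?sqr_ge0// ltW.
    have cz : cost a <= cost z.1 by rewrite cost_le ?(q_ge0 ok)// ltW.
    have rz : D * (r * (z.2 - t0)) <= D * (r * T).
      rewrite ler_pM2l// ler_pM2l// lerBlDr (le_trans z4)//.
      by rewrite (le_trans tht1)// (le_trans (ltW t1T))// lerDl.
    rewrite /residual /Lop.
    rewrite [leLHS](_ : _ = - cost z.1 + D * (1 + r * (z.2 - t0)) + A * sigma ^+ 2
       + 2 * (A * (drift * (z.1 - m))) - r * (A * (z.1 - m) ^+ 2)); last by rewrite /cost /v /payoff; field.
    by move: AM; rewrite /M; move: dz g0 cz rz DM A0; isolate; lra.
  - move=> z z1 z2 z3 z4 _; apply: (os_sub oy).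
    + exact: lt_le_trans bk.
    + exact: le_lt_trans z3.
    + by apply: le_lt_trans z4 _; exact: le_lt_trans t1T.
    + by case: z z1 z2 z3 z4 => x s /= *; apply: ync => //; exact: le_trans tht1.
  - move=> s s1 s2; have sh : `|s - t0| <= h.
      by move: s1 s2; isolate; move=> *; apply/ler_normlP; split; lra.
    have := daP (a, s); rewrite /= subrr normr0 => /(_ da0 (le_lt_trans sh hda)).
    rewrite yt0 ?lexx ?(ltW ab)// psi1_payoff// => /ltr_normlP[_].
    have : D * (s - t0) <= D * h by rewrite ler_pM2l//; move: s2; isolate; lra.
    rewrite /v /= (_ : (a - m) ^+ 2 = w ^+ 2); last by rewrite aE; ring.
    by move: hD; isolate; lra.
  - move=> s s1 s2; have sh : `|s - t0| <= h.
      by move: s1 s2; isolate; move=> *; apply/ler_normlP; split; lra.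
    have := dbP (b, s); rewrite /= subrr normr0 => /(_ db0 (le_lt_trans sh hdb)).
    rewrite yt0 ?lexx ?(ltW ab)// psi1_payoff// => /ltr_normlP[_].
    have : D * (s - t0) <= D * h by rewrite ler_pM2l//; move: s2; isolate; lra.
    rewrite /v /= (_ : (b - m) ^+ 2 = w ^+ 2); last by rewrite bE; ring.
    by move: hD; isolate; lra.
  - move=> x x1 x2; rewrite /v /= yt0// psi1_payoff ?(le_trans Ka)// subrr mulr0 addr0.
    by rewrite gerBl mulr_ge0 ?sqr_ge0// ltW.
have := os_ge oy (z := (m, t0 + h)) (le_trans mb bk) (le_trans t00 th) (le_trans tht1 (ltW t1T)).
rewrite /= psi1_payoff ?(le_trans Ka)//.
move: main; rewrite /v /= subrr expr0n /= mulr0 subr0 addrAC subrr add0r.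
have : 0 < D * h by rewrite mulr_gt0.
by isolate; lra.
Qed.

End contact.

(** * Strict inequalities from the Hopf barrier *)

Section strictness.
Context {R : realType}.
Variables (K1 k1 K2 sigma r q T : R).
Implicit Types (y : R * R -> R) (x s t h : R).
Notation psi := (psi1 K1 k1 K2).
Notation payoff := (payoff K1 k1 K2).
Notation cost := (cost K1 k1 K2 r q).
Notation obstacle_solution := (obstacle_solution K1 k1 K2 sigma r q T).
Notation admissible := (admissible K1 k1 K2 sigma r q T).
Local Ltac isolate := clear -K1 k1 K2 sigma r q T.

Lemma supersol_at_opp_payoff z : 0 <= q -> z.1 < ln k1 -> cost (ln k1) <= 0 ->
  supersol_at sigma r q (fun w => - payoff w.1) z.
Proof.
move=> q0 z1 ck; have [|d d0 /andP[dk _]] := ex_small (s := [:: ln k1 - z.1]).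
  by rewrite /= andbT subr_gt0.
exists d => // e e0.
exists (fun w => - payoff w.1), (fun w => - expR w.1), (fun w => - expR w.1), (fun w => 0); split.
  apply: continuous_subspaceT => w; apply: cvgN.
  by apply: (@continuous_comp _ _ _ fst payoff); [exact: cvg_fst|exact: payoff_continuous].
move=> w /boxP[_ wd _ _]; split.
- by split; rewrite /payoff /=; apply: is_derive_eq; rewrite /GRing.scale /=; ring.
- by rewrite subrr normr0 ltW.
- rewrite /residual /Lop [leRHS](_ : _ = - cost w.1); last by rewrite /cost /payoff; field.
  rewrite oppr_ge0 (le_trans _ ck)// cost_le//.
  by move: wd dk; isolate; lra.
Qed.

(** The difference [y - payoff] is a nonnegative supersolution, bounded below on the edge [ln K1] by
    its positive value at time [s / 4], since [y] is nondecreasing in time. The barrier then gives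
    growth proportional to [ln k1 - x], incompatible with contact at [x < ln k1]. *)
Lemma noncontact_all y x s : admissible -> obstacle_solution y -> cost (ln k1) <= 0 ->
  ln K1 <= x -> x < ln k1 -> 0 < s -> s <= T -> psi x < y (x, s).
Proof.
move=> ok oy ck; rewrite le_eqVlt => /predU1P[<- _|Kx xk] s0 sT.
  exact: noncontact_lnK1 ok oy _ _.
have K10 := K1_gt0 ok; have Kk := lnK1_lt_lnk1 ok; have cy := os_continuous oy.
rewrite lt_neqAle (os_ge oy (z := (x, s)) (ltW xk) (ltW s0) sT) andbT.
apply/eqP => /esym ys.
have [h0 h1 h2 h3] : [/\ 0 < s / 4, s / 4 < s / 2, 0 < s / 2 & s / 2 < s].
  by move: s0; isolate; split; lra.
have hT : s / 2 < T by exact: lt_le_trans sT.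
have := contact_backward ok oy (ltW xk) (ltW h2) (ltW h3) sT ys.
rewrite psi1_payoff// ?(ltW Kx)// => yp.
pose u := y \+ (fun w => - payoff w.1).
have cu : continuous u.
  move=> w; apply: cvgD; first exact: cy.
  apply: cvgN.
  by apply: (@continuous_comp _ _ _ fst payoff); [exact: cvg_fst|exact: payoff_continuous].
have m0 : 0 < u (ln K1, s / 4).
  have h4 := ltW (lt_trans h1 hT).
  have := noncontact_lnK1 ok oy h0 h4.
  by rewrite psi1_payoff// /u /= subr_gt0.
have u0 z : ln K1 <= z.1 -> z.1 <= ln k1 -> s / 4 <= z.2 -> z.2 <= s / 2 -> 0 <= u z.
  move=> z1 z2 z3 z4; rewrite /u /= subr_ge0 -psi1_payoff//; apply: (os_ge oy) => //.
    exact: le_trans (ltW h0) z3.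
  exact: le_trans z4 (ltW hT).
have um t : s / 4 <= t -> t <= s / 2 -> u (ln K1, s / 4) <= u (ln K1, t).
  move=> t1 t2; rewrite /u /= lerD2r.
  apply: (obstacle_solution_nondecreasing ok oy) => //; [exact: ltW|exact: ltW|].
  exact: le_trans t2 (ltW hT).
have Su z : ln K1 < z.1 -> z.1 < ln k1 -> s / 4 < z.2 -> z.2 <= s / 2 -> supersol_at sigma r q u z.
  move=> z1 z2 z3 z4; apply: supersol_atD; last exact: supersol_at_opp_payoff (q_ge0 ok) _ _.
  by apply: (os_super oy) => //; [exact: lt_trans z3|exact: le_lt_trans hT].
have [k k0 kP] := linear_growth (sigma_gt0 ok) (r_gt0 ok) Kk h1 m0 cu u0 um Su.
have := kP x (ltW Kx) (ltW xk); rewrite /u /= yp subrr.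
by rewrite pmulr_rle0// subr_le0 leNgt xk.
Qed.

(** A fixed endpoint [b] provides a fixed rectangle left of [b] that is free of contact, where the
    time increment of [y] is a nonnegative supersolution to which the Hopf barrier applies. *)
Lemma no_stationary_boundary y b s t : admissible -> obstacle_solution y ->
  ln K1 < b -> b < ln k1 -> 0 < s -> s < t -> t <= T -> y (b, t) = psi b ->
  (forall x tau, ln K1 < x -> x < b -> s < tau -> tau < t -> psi x < y (x, tau)) -> False.
Proof.
move=> ok oy Kb bk s0 st tT ybt ync.
have K10 := K1_gt0 ok; have Kk := lnK1_lt_lnk1 ok; have cy := os_continuous oy.
have sg := sigma_gt0 ok; have r0 := r_gt0 ok.
(* Four steps: the increment [u] is studied on [[s, s + h]]; its growth at [s + h] bounds [y] from
   below at [s + 2h] and later; the kink is placed at [s + 3h], leaving a past of length [h]; and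
   [s + 3h] is still before [t]. *)
pose h := (t - s) / 4.
have h0 : 0 < h by rewrite divr_gt0// subr_gt0.
have htE : t = s + 4 * h by rewrite /h; field.
clearbody h.
have sh : s < s + h by rewrite ltrDl.
have mono := obstacle_solution_nondecreasing ok oy.
have b3 : s + 3 * h < t by rewrite htE; move: h0; isolate; lra.
have tau_h tau : tau <= s + h -> tau + h < t by rewrite htE; move: h0; isolate; lra.
pose u := (fun w => y (w.1, w.2 + h)) \+ (\- y).
have cyh := continuous_shift (h := h) cy.
have cu : continuous u.
  by move=> w; apply: cvgD; [exact: cyh|apply: cvgN; exact: cy].
have u_ge0 z : z.1 <= ln k1 -> 0 <= z.2 -> z.2 <= s + h -> 0 <= u z.
  move=> z1 z2 z3; rewrite /u /= subr_ge0 [y z](_ : _ = y (z.1, z.2)); last by case: (z).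
  apply: mono => //; first by rewrite lerDl ltW.
  exact: le_trans (ltW (tau_h _ z3)) tT.
have Su z : z.1 < ln k1 -> 0 < z.2 -> z.2 <= s + h -> psi z.1 < y z -> supersol_at sigma r q u z.
  move=> z1 z2 z3 zc; have z4 := lt_le_trans (tau_h _ z3) tT.
  have z5 : 0 < z.2 + h by rewrite addr_gt0.
  apply: supersol_atD.
    by apply: supersol_at_shift; apply: (os_super oy).
  by apply: (os_sub oy) => //; apply: lt_trans z4; rewrite ltrDl.
(* At time [0] the increment at [ln K1] is positive because [y] leaves the obstacle there at once.
   Continuity carries this to a small positive time [ss]. From then on a thin strip around [ln K1]
   is free of contact by monotonicity in time, and positivity propagates along it. *)
have upos tau : s <= tau -> tau <= s + h -> 0 < u (ln K1, tau).
  move=> stau taus.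
  have u00 : 0 < u (ln K1, 0).
    rewrite /u /= subr_gt0 (os_init oy) ?(ltW Kk)// add0r.
    apply: (noncontact_lnK1 ok oy h0); apply: le_trans tT; apply: ltW.
    by rewrite htE; move: h0 s0; isolate; lra.
  pose m := u (ln K1, 0) / 2; have m0 : 0 < m by rewrite divr_gt0.
  have [d d0 dP] := continuous_square (ln K1, 0) cu m0.
  have [|ss ss0 /and3P[ssd sss _]] := ex_small (s := [:: d; s]); first by rewrite /= d0 s0.
  have ssT : ss < T by apply: lt_trans sss _; exact: lt_le_trans st tT.
  have cpsi : continuous (fun w => y w - psi w.1).
    move=> w; apply: cvgB; first exact: cy.
    by apply: (@continuous_comp _ _ _ fst psi); [exact: cvg_fst|exact: psi1_continuous].
  have e0 : 0 < y (ln K1, ss) - psi (ln K1).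
    by rewrite subr_gt0; apply: (noncontact_lnK1 ok oy) => //; exact: ltW.
  have [d' d'0 d'P] := continuous_square (ln K1, ss) cpsi e0.
  have [|rho rho0 /and4P[rd rd' rk _]] := ex_small (s := [:: d; d'; ln k1 - ln K1]).
    by rewrite /= d0 d'0 subr_gt0 Kk.
  have near_x x : ln K1 - rho <= x -> x <= ln K1 + rho -> `|x - ln K1| <= rho /\ x < ln k1.
    by move: rk; isolate; move=> *; split; [apply/ler_normlP; split|]; lra.
  apply: (positivity_propagates (rho := rho) (s0 := ss) (m := m) sg r0 rho0 _ m0 cu).
  - exact: le_trans (ltW sss) stau.
  - move=> z z1 z2 z3 z4; have [_ /ltW zk] := near_x _ z1 z2; apply: u_ge0 => //.
      exact: le_trans (ltW ss0) z3.
    exact: le_trans z4 taus.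
  - move=> x x1 x2; have [xr _] := near_x _ x1 x2.
    have := dP (x, ss); rewrite /= subr0 (gtr0_norm ss0) => /(_ (le_lt_trans xr rd) ssd).
    by move=> /ltr_normlP[+ _]; rewrite /m; isolate; lra.
  - move=> z /ltW z1 /ltW z2 z3 z4; have [xr zk] := near_x _ z1 z2.
    have z20 := lt_trans ss0 z3; have z4' := le_trans z4 taus.
    apply: Su => //.
    have := d'P (z.1, ss); rewrite /= subrr normr0 => /(_ (le_lt_trans xr rd') d'0).
    move=> /ltr_normlP[+ _].
    have zT : z.2 <= T.
      apply: le_trans tT; apply: ltW; apply: lt_trans (tau_h _ z4').
      by rewrite ltrDl.
    have := mono z.1 ss z.2 (ltW zk) (ltW ss0) (ltW z3) zT.
    by rewrite -surjective_pairing; isolate; lra.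
have cuK : {within `[s, s + h], continuous (fun tau => u (ln K1, tau))}.
  apply: continuous_subspaceT => tau; apply/cvgrPdist_lt => e e0.
  have [d d0 dP] := continuous_square (ln K1, tau) cu e0.
  apply: (iffRL (@nbhs_ballP R R tau _)); exists d => // tau' td.
  rewrite distrC; apply: dP => /=; first by rewrite subrr normr0.
  by rewrite distrC.
have [t0 t0s t0min] := EVT_min (ltW sh) cuK.
move: t0s; rewrite in_itv /= => /andP[t0s t0h].
have m0 := upos t0 t0s t0h.
have [k k0 kP] : exists2 k, 0 < k & forall x, ln K1 <= x -> x <= b -> k * (b - x) <= u (x, s + h).
  apply: (linear_growth sg r0 Kb sh m0 cu).
  - move=> z z1 z2 z3 z4; apply: u_ge0 => //; first exact: le_trans (ltW bk).
    exact: le_trans (ltW s0) z3.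
  - by move=> tau t1 t2; apply: t0min; rewrite in_itv /= t1.
  - move=> z z1 z2 z3 z4; apply: Su => //; [exact: lt_trans bk|exact: lt_trans z3|].
    have := ync z.1 z.2 z1 z2 z3; rewrite -surjective_pairing; apply.
    by apply: lt_trans (tau_h _ z4); rewrite ltrDl.
have kink : payoff b < y (b, s + 3 * h).
  have [|rho rho0 /and4P[/ltW rK rk /ltW rh _]] :=
      ex_small (s := [:: b - ln K1; ln k1 - b; h]).
    by rewrite /= !subr_gt0 Kb bk h0.
  have k20 : 0 < k / 2 by rewrite divr_gt0.
  (* Right of [b] the tangent line of [payoff] is a lower bound; left of [b] the bound improves by
     [k (b - x)]. Writing that gain as [- (k / 2) (x - b) + (k / 2) |x - b|] gives [alpha] and
     [kappa]. *)
  apply: (kink_strict (alpha := expR b - k / 2) (rho0 := rho) sg r0 rho0 k20 cy).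
  move=> z /ler_normlP[zr1 zr2] z1 z2.
  have [h1 h2' h3] : [/\ ln K1 <= z.1, z.1 < ln k1 & s + 2 * h <= z.2].
    by move: zr1 zr2 z1 rK rk rh; isolate; split; lra.
  have h2 := ltW h2'.
  have h4 : 0 <= s + 2 * h by rewrite addr_ge0 ?mulr_ge0// ltW.
  have h5 : z.2 < T by exact: lt_le_trans (le_lt_trans z2 b3) tT.
  have h6 : 0 < z.2 by apply: lt_le_trans h3; rewrite ltr_wpDr// mulr_ge0// ltW.
  have tangent : payoff b + expR b * (z.1 - b) <= payoff z.1.
    have := expR_ge1Dx (z.1 - b); rewrite -(ler_pM2l (expR_gt0 b)) -expRD (_ : b + (z.1 - b) = z.1); last by ring.
    by rewrite mulrDr mulr1 /payoff; isolate; lra.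
  split; first exact: (os_super oy).
  have [zb|bz] := leP z.1 b; last first.
    rewrite gtr0_norm ?subr_gt0//.
    apply: (@le_trans _ _ (payoff z.1)); first by move: tangent; isolate; lra.
    by apply: le_trans (payoff_le_psi1 _ _ _ _) _; apply: (os_ge oy) => //; exact: ltW.
  rewrite ler0_norm ?subr_le0//.
  have h7 : y (z.1, s + 2 * h) <= y z.
    by have := mono z.1 _ _ h2 h4 h3 (ltW h5); rewrite -surjective_pairing.
  have := kP z.1 h1 zb; rewrite /u /= (_ : s + h + h = s + 2 * h); last by ring.
  have sT : s + h <= T by apply: le_trans tT; rewrite htE; move: h0; isolate; lra.
  have := os_ge oy (z := (z.1, s + h)) h2 (ltW (lt_trans s0 sh)) sT.
  have := payoff_le_psi1 K1 k1 K2 z.1.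
  by move: h7 tangent; rewrite /=; isolate; lra.
have h4 : 0 <= s + 3 * h by rewrite addr_ge0 ?mulr_ge0// ltW.
have := contact_backward ok oy (ltW bk) h4 (ltW b3) tT ybt.
by rewrite psi1_payoff ?(ltW Kb)// => yb; move: kink; rewrite yb ltxx.
Qed.

End strictness.

(** * The free boundary *)

Section boundary.
Context {R : realType}.
Variables (K1 k1 K2 sigma r q T : R).
Implicit Types (y Y : R * R -> R) (B : R -> R) (x s t : R).
Notation psi := (psi1 K1 k1 K2).
Notation cost := (cost K1 k1 K2 r q).
Notation xi := (xi K1 k1 K2 r q).
Notation obstacle_solution := (obstacle_solution K1 k1 K2 sigma r q T).
Notation admissible := (admissible K1 k1 K2 sigma r q T).
Notation is_upper_free_boundary := (is_upper_free_boundary K1 k1 K2 T).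
Local Ltac isolate := clear -K1 k1 K2 sigma r q T.

(** As [ln K1 < ln k1], the inequality [ln k1 <= xi] can only come from the logarithmic term of the
    maximum. *)
Lemma cost_lnk1_le0 : admissible ->
  (q = 0 /\ K2 <= K1 + k1) \/ (0 < q /\ ln k1 <= xi) -> cost (ln k1) <= 0.
Proof.
move=> ok; have K10 := K1_gt0 ok; have k10 := lt_trans K10 (K1_lt_k1 ok).
have r0 := r_gt0 ok; have Kk := lnK1_lt_lnk1 ok.
rewrite /cost lnK ?posrE// subr_le0 => -[[-> K2k]|[q0]].
  by rewrite mul0r mulr_ge0 ?subr_ge0// ltW.
rewrite /Defs.xi gt_eqF//=; case: ifPn => [_|]; first by rewrite leNgt Kk.
rewrite -ltNge => K2k; rewrite le_max [_ <= ln K1]leNgt Kk /=.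
rewrite ler_ln ?posrE//; last by rewrite divr_gt0// mulr_gt0// subr_gt0.
by rewrite ler_pdivlMr// mulrC.
Qed.

Lemma lnK1_le_xi : ln K1 <= xi.
Proof. by rewrite /Defs.xi; case: ifP => // _; rewrite le_max lexx. Qed.

Lemma cost_gt0 x : admissible ->
  (q = 0 /\ K1 + k1 < K2) \/ (0 < q /\ xi < ln k1) -> xi < x -> 0 < cost x.
Proof.
move=> ok; have r0 := r_gt0 ok; rewrite /cost subr_gt0 => -[[-> K2k] _|[q0 _]].
  by rewrite mul0r pmulr_rlt0// subr_lt0.
rewrite /Defs.xi gt_eqF//=; case: ifPn => [K2k _|].
  apply: (@le_lt_trans _ _ 0); last by rewrite mulr_gt0// expR_gt0.
  by rewrite pmulr_rle0// subr_le0.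
rewrite -ltNge => K2k; rewrite gt_max => /andP[_ Lx].
have L0 : 0 < r * (K1 + k1 - K2) / q by rewrite divr_gt0// mulr_gt0// subr_gt0.
by move: Lx; rewrite -ltr_expR lnK ?posrE// ltr_pdivrMr// (mulrC q).
Qed.

Lemma cost_lt0 x : admissible -> ln K1 < x -> x < xi -> cost x < 0.
Proof.
move=> ok Kx; have r0 := r_gt0 ok; rewrite /cost subr_lt0 /Defs.xi.
case: ifPn => [_ /(lt_trans Kx)|]; first by rewrite ltxx.
rewrite negb_or -ltNge => /andP[q0 K2k].
have {}q0 : 0 < q by rewrite lt_neqAle eq_sym q0 (q_ge0 ok).
have L0 : 0 < r * (K1 + k1 - K2) / q by rewrite divr_gt0// mulr_gt0// subr_gt0.
rewrite lt_max [x < ln K1]ltNge (ltW Kx)/= -ltr_expR lnK ?posrE//.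
by rewrite ltr_pdivlMr// (mulrC q).
Qed.

Section free_boundary.
Variables (y : R * R -> R) (B : R -> R).

Lemma boundary_contact : admissible -> obstacle_solution y -> is_upper_free_boundary y B ->
  forall s, 0 < s -> s <= T -> [/\ ln K1 < B s, B s <= ln k1 & y (B s, s) = psi (B s)].
Proof.
move=> ok oy hB s s0 sT; have K10 := K1_gt0 ok.
have [[/andP[KB Bk] yB] _] := hB s ltac:(by rewrite s0).
have yp : y (B s, s) = psi (B s) by rewrite yB psi1_payoff.
split => //; rewrite lt_neqAle KB andbT; apply/eqP => BK.
by have := noncontact_lnK1 ok oy s0 sT; rewrite BK yp ltxx.
Qed.

Lemma boundary_noncontact : admissible -> obstacle_solution y -> is_upper_free_boundary y B ->
  forall x s, 0 < s -> s <= T -> ln K1 <= x -> x < B s -> psi x < y (x, s).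
Proof.
move=> ok oy hB x s s0 sT Kx xB; have K10 := K1_gt0 ok.
have [_ Bk _] := boundary_contact ok oy hB s0 sT.
have xk := ltW (lt_le_trans xB Bk).
rewrite lt_neqAle (os_ge oy (z := (x, s)) xk (ltW s0) sT) andbT; apply/eqP => /esym yx.
have [_ lb] := hB s ltac:(by rewrite s0).
suff : B s <= x by rewrite leNgt xB.
by apply: lb; split; [rewrite Kx|rewrite yx psi1_payoff].
Qed.

Lemma boundary_nondecreasing : admissible -> obstacle_solution y -> is_upper_free_boundary y B ->
  forall s t, 0 < s -> s <= t -> t <= T -> B s <= B t.
Proof.
move=> ok oy hB s t s0 st tT.
have [KB Bk yB] := boundary_contact ok oy hB (lt_le_trans s0 st) tT.
rewrite leNgt; apply/negP => BB.
have := boundary_noncontact ok oy hB s0 (le_trans st tT) (ltW KB) BB.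
by rewrite (contact_backward ok oy Bk (ltW s0) st tT yB) ltxx.
Qed.

Lemma boundary_cost_ge0 : admissible -> obstacle_solution y -> is_upper_free_boundary y B ->
  0 < cost (ln k1) -> forall s, 0 < s -> s <= T -> 0 <= cost (B s).
Proof.
move=> ok oy hB ck s s0 sT.
have [KB Bk yB] := boundary_contact ok oy hB s0 sT.
move: Bk; rewrite le_eqVlt => /predU1P[->|Bk]; first exact: ltW.
rewrite leNgt; apply/negP => cB.
by have := noncontact_below ok oy KB Bk s0 sT cB; rewrite yB ltxx.
Qed.

Lemma boundary_contact_above : admissible -> obstacle_solution y -> is_upper_free_boundary y B ->
  0 < cost (ln k1) -> forall x s, 0 < s -> s < T -> B s <= x -> x <= ln k1 ->
  y (x, s) = psi x.
Proof.
move=> ok oy hB ck x s s0 sT Bx xk.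
have [/ltW KB _ yB] := boundary_contact ok oy hB s0 (ltW sT).
have cB := boundary_cost_ge0 ok oy hB ck s0 (ltW sT).
exact: (contact_interval ok oy KB cB sT yB Bx xk (ltW s0) (lexx _)).
Qed.

Lemma boundary_increasing : admissible -> obstacle_solution y -> is_upper_free_boundary y B ->
  forall s t, 0 < s -> s < t -> t <= T -> B t < ln k1 -> B s < B t.
Proof.
move=> ok oy hB s t s0 st tT Bk; rewrite lt_neqAle.
rewrite (boundary_nondecreasing ok oy hB s0 (ltW st) tT) andbT; apply/eqP => BE.
have [KB _ yB] := boundary_contact ok oy hB (lt_trans s0 st) tT.
apply: (no_stationary_boundary ok oy KB Bk s0 st tT yB) => x tau Kx xB stau taut.
have tauT := le_trans (ltW taut) tT.
apply: (boundary_noncontact ok oy hB (lt_trans s0 stau) tauT (ltW Kx)).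
apply: lt_le_trans xB _; rewrite -BE.
exact: (boundary_nondecreasing ok oy hB s0 (ltW stau) tauT).
Qed.

(** Used with [a0 = B t0] for right continuity and with [t0 = 0], [a0 = xi] for the initial limit,
    where the initial data supply the contact. Once [B] is below [beta] at one time, monotonicity
    gives it at all earlier ones. Otherwise contact on an interval at [t0] is lost at once, contrary
    to [contact_persists]. *)
Lemma boundary_right_limit a0 beta t0 : admissible -> obstacle_solution y ->
  is_upper_free_boundary y B -> 0 <= t0 -> t0 < T -> ln K1 <= a0 ->
  (forall x, a0 < x -> 0 < cost x) ->
  (forall x, a0 <= x -> x <= ln k1 -> y (x, t0) = psi x) -> a0 < beta ->
  exists2 t1, t0 < t1 & forall s, t0 < s -> s < t1 -> s <= T -> B s < beta.
Proof.
move=> ok oy hB t00 t0T Ka0 ca0 yt0 ab.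
have [bk|kb] := leP beta (ln k1); last first.
  exists T => // s t0s _ sT; have [_ Bk _] := boundary_contact ok oy hB (le_lt_trans t00 t0s) sT.
  exact: le_lt_trans kb.
have [|H] := pselect (exists s, [/\ t0 < s, s < T & B s < beta]).
  move=> [t1 [t01 t1T Bt1]]; exists t1 => // s t0s st1 sT.
  apply: le_lt_trans Bt1; apply: (boundary_nondecreasing ok oy hB (le_lt_trans t00 t0s)) => //;
    exact: ltW.
(* The cost may vanish at [a0]; the midpoint makes it strictly positive. *)
exfalso; pose a := (a0 + beta) / 2; pose t1 := (t0 + T) / 2.
have [a0a aB] : a0 < a /\ a < beta by rewrite /a; move: ab; isolate; split; lra.
have [t01 t1T] : t0 < t1 /\ t1 < T by rewrite /t1; move: t0T; isolate; split; lra.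
have Ka := le_trans Ka0 (ltW a0a).
apply: (contact_persists ok oy Ka aB bk (ca0 _ a0a) t00 t01 t1T).
  by move=> x ax xb; apply: yt0; [exact: le_trans (ltW a0a) ax|exact: le_trans bk].
move=> x s ax xb t0s st1; have sT := le_lt_trans st1 t1T.
apply: (boundary_noncontact ok oy hB (le_lt_trans t00 t0s) (ltW sT)).
  exact: le_trans Ka (ltW ax).
apply: (lt_le_trans xb); rewrite leNgt; apply/negP => Bs; apply: H.
by exists s.
Qed.

(** A point between [beta] and [B t0] is off contact at [t0]. Were [B s <= beta] at times close
    before [t0], that point would be in contact then, contradicting the continuity of [y]. *)
Lemma boundary_left_limit beta t0 : admissible -> obstacle_solution y ->
  is_upper_free_boundary y B -> 0 < cost (ln k1) -> 0 < t0 -> t0 <= T -> beta < B t0 ->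
  exists2 d, 0 < d & forall s, 0 < s -> s < t0 -> t0 - s < d -> beta < B s.
Proof.
move=> ok oy hB ck t00 t0T bB.
have [KB Bk yB] := boundary_contact ok oy hB t00 t0T.
(* Noncontact left of the boundary is known from [ln K1] on only, while [beta] is arbitrary. *)
pose b := Num.max beta (ln K1).
have bBt : b < B t0 by rewrite gt_max bB.
have Kb : ln K1 <= b by rewrite le_max lexx orbT.
have bb : beta <= b by rewrite le_max lexx.
have e0 : 0 < y (b, t0) - psi b.
  by rewrite subr_gt0; exact: (boundary_noncontact ok oy hB t00 t0T Kb bBt).
have [d d0 dP] := continuous_square (b, t0) (os_continuous oy) e0.
exists d => // s s0 st0 sd; rewrite ltNge; apply/negP => Bb.
have sT := lt_le_trans st0 t0T.
have ys := boundary_contact_above ok oy hB ck s0 sT (le_trans Bb bb) (ltW (lt_le_trans bBt Bk)).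
have := dP (b, s); rewrite /= subrr normr0 ys => /(_ d0).
rewrite distrC gtr0_norm ?subr_gt0// => /(_ sd) /ltr_normlP[+ _].
by isolate; lra.
Qed.

Lemma boundary_continuous : admissible -> obstacle_solution y -> is_upper_free_boundary y B ->
  (q = 0 /\ K1 + k1 < K2) \/ (0 < q /\ xi < ln k1) -> xi < ln k1 ->
  {within [set tau : R | 0 < tau <= T], continuous B}.
Proof.
move=> ok oy hB hq xik; apply/subspace_continuousP => t0 /= /andP[t00 t0T].
have ck := cost_gt0 ok hq xik.
apply/cvgrPdist_lt => e e0.
have bl : B t0 - e < B t0 by rewrite gtrBl.
have br : B t0 < B t0 + e by rewrite ltrDl.
have [d d0 dP] := boundary_left_limit ok oy hB ck t00 t0T bl.
have [t1 t01 t1P] : exists2 t1, t0 < t1 & forall s, t0 < s -> s < t1 -> s <= T -> B s < B t0 + e.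
  move: t0T; rewrite le_eqVlt => /predU1P[t0T|t0T].
    by exists (t0 + 1); rewrite ?ltrDl// => s t0s _; rewrite -t0T leNgt t0s.
  have [KB Bk yB] := boundary_contact ok oy hB t00 (ltW t0T).
  apply: (boundary_right_limit ok oy hB (ltW t00) t0T (ltW KB)) br.
    move=> x Bx; apply: (cost_gt0 ok hq); apply: le_lt_trans Bx; rewrite leNgt; apply/negP => Bxi.
    have := noncontact_below ok oy KB (lt_trans Bxi xik) t00 (ltW t0T) (cost_lt0 ok KB Bxi).
    by rewrite yB ltxx.
  by move=> x Bx xk; exact: (boundary_contact_above ok oy hB ck t00 t0T Bx xk).
have [|d' d'0 /and3P[d'd d't _]] := ex_small (s := [:: d; t1 - t0]).
  by rewrite /= d0 subr_gt0 t01.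
rewrite /within /=; apply: (iffRL (@nbhs_ballP R R t0 _)); exists d' => // s ts /andP[s0 sT].
rewrite /from_subspace; move: ts; rewrite /ball /= => /ltr_normlP[ts1 ts2].
have [st|ts|->] := ltgtP s t0; last by rewrite subrr normr0.
- have := dP s s0 st ltac:(by move: ts1 ts2 d'd; isolate; lra).
  have := boundary_nondecreasing ok oy hB s0 (ltW st) t0T.
  by move: e0; isolate; move=> *; apply/ltr_normlP; split; lra.
- have := t1P s ts ltac:(by move: ts1 ts2 d't; isolate; lra) sT.
  have := boundary_nondecreasing ok oy hB t00 (ltW ts) sT.
  by move: e0; isolate; move=> *; apply/ltr_normlP; split; lra.
Qed.

Lemma boundary_initial_limit : admissible -> obstacle_solution y -> is_upper_free_boundary y B ->
  (q = 0 /\ K1 + k1 < K2) \/ (0 < q /\ xi < ln k1) -> xi < ln k1 ->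
  B tau @[tau --> 0^'+] --> xi.
Proof.
move=> ok oy hB hq xik; have T0 := T_gt0 ok.
apply/cvgrPdist_lt => e e0.
have br : xi < xi + e by rewrite ltrDl.
have [t1 t10 t1P] : exists2 t1, 0 < t1 & forall s, 0 < s -> s < t1 -> s <= T -> B s < xi + e.
  apply: (boundary_right_limit ok oy hB (lexx _) T0 lnK1_le_xi _ _ br).
    by move=> x; exact: cost_gt0.
  by move=> x _ xk; exact: (os_init oy).
near=> s.
have s0 : 0 < s by near: s; exact: nbhs_right_gt.
have st : s < t1 by near: s; exact: nbhs_right_lt.
have sT : s < T by near: s; exact: nbhs_right_lt.
have Bs := t1P s s0 st (ltW sT).
have [KB Bk yB] := boundary_contact ok oy hB s0 (ltW sT).
have xiB : xi <= B s.
  rewrite leNgt; apply/negP => Bxi.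
  have := noncontact_below ok oy KB (lt_trans Bxi xik) s0 (ltW sT) (cost_lt0 ok KB Bxi).
  by rewrite yB ltxx.
by move: Bs xiB e0; isolate; move=> *; apply/ltr_normlP; split; lra.
Unshelve. all: end_near. Qed.

End free_boundary.
End boundary.

Theorem theorem4p5 (R : realType) (K1 k1 k2 K2 sigma r q T p : R)
    (hK1 : 0 < K1) (hK1k1 : K1 < k1) (hk1k2 : k1 < k2) (hk2K2 : k2 < K2)
    (hsigma : 0 < sigma) (hr : 0 < r) (hq : 0 <= q) (hT : 0 < T) (hp : 1 < p)
    (Y : R * R -> R)
    (hY : bounded_strong_solution K1 k1 K2 sigma r q T p Y)
    (B : R -> R) (hB : is_upper_free_boundary K1 k1 K2 T Y B) :
  ((q = 0 /\ K2 <= K1 + k1) \/ (0 < q /\ ln k1 <= xi K1 k1 K2 r q) ->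
     (forall tau : R, 0 < tau <= T -> B tau = ln k1) /\
     (forall x tau : R, ln K1 <= x < ln k1 -> 0 < tau <= T ->
        psi1 K1 k1 K2 x < Y (x, tau)))
  /\
  ((q = 0 /\ K1 + k1 < K2) \/ (0 < q /\ xi K1 k1 K2 r q < ln k1) ->
     [/\ forall s t : R, 0 < s -> s <= t -> t <= T -> B s <= B t,
         {within [set tau : R | 0 < tau <= T], continuous B},
         forall s t : R, 0 < s <= T -> B s < ln k1 -> 0 < t <= T -> B t < ln k1 ->
           s < t -> B s < B t &
         B tau @[tau --> 0^'+] --> xi K1 k1 K2 r q]).
Proof.
have ok : admissible K1 k1 K2 sigma r q T by split => //; exact: lt_trans hk2K2.
have oy := strong_solution_obstacle hK1 hK1k1 hT hY.
set y := Y \o _ in oy.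
have yE x s : x <= ln k1 -> 0 <= s -> s <= T -> y (x, s) = Y (x, s).
  by move=> xk s0 sT; rewrite /y /= clampE.
have hB' : is_upper_free_boundary K1 k1 K2 T y B.
  move=> s sT; have [[Bk YB] lb] := hB s sT; move/andP: (sT) => [/ltW s0 sT'].
  split; first by split => //; rewrite yE//; case/andP: Bk.
  move=> x [xk yx]; apply: lb; split => //.
  by rewrite -yE//; case/andP: xk.
split=> [hi|hii].
  have nc := noncontact_all ok oy (cost_lnk1_le0 ok hi).
  split=> [s /andP[s0 sT]|x s /andP[Kx xk] /andP[s0 sT]]; last first.
    by rewrite -yE ?(ltW xk) ?(ltW s0)//; exact: nc.
  have [KB Bk yB] := boundary_contact ok oy hB' s0 sT.
  apply/eqP; rewrite eq_le Bk leNgt; apply/negP => Bk'.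
  by have := nc _ _ (ltW KB) Bk' s0 sT; rewrite yB ltxx.
(* For [q = 0] the convention makes [xi] equal to [ln K1], so both alternatives of (ii) yield this
   inequality. *)
have xik : xi K1 k1 K2 r q < ln k1.
  case: hii => [[q0 _]|[_ //]]; rewrite /xi q0 eqxx /=; exact: lnK1_lt_lnk1 ok.
split.
- exact: boundary_nondecreasing ok oy hB'.
- exact: boundary_continuous ok oy hB' hii xik.
- move=> s t /andP[s0 _] _ /andP[_ tT] Bt st.
  exact: (boundary_increasing ok oy hB' s0 st tT Bt).
- exact: (boundary_initial_limit ok oy hB' hii xik).
Qed.
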